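(* Let $\mathcal{P}=(R,E,S)$ be a terminating $n$-polygraph modulo, and let $\Gamma$ be a square extension of $\mathcal{P}$. If $\mathcal{P}$ is locally $\Gamma$-confluent, then $\mathcal{P}$ is $\Gamma$-confluent.
   Context: **Polygraphs.** $n$-categories are strict and globular; $\star_i$ is composition along $i$-cells; $\partial_-(f),\partial_+(f)$ are the codimension-one source and target of a cell $f$. A cellular extension of a $k$-category $\mathcal{C}$ is a set $X$ with a map from $X$ to the set of $k$-spheres (pairs of parallel $k$-cells) of $\mathcal{C}$; $\mathcal{C}[X]$ is the free $(k+1)$-category obtained by adjoining the elements of $X$ as $(k+1)$-cells. An $n$-polygraph $P=(P_0,\dots,P_n)$ is a set $P_0$ with, for $0\le k<n$, a cellular extension $P_{k+1}$ of $P_k^\ast=P_0[P_1]\cdots[P_k]$; $P^\ast=P_n^\ast$, and $P_{\leq k}=(P_0,\dots,P_k)$. The size of an $n$-cell is the number of generating $n$-cells it contains; $P^{\ast(1)}$ is the set of $n$-cells of size $1$, called rewriting steps. A whisker of $P_{n-1}^\ast$ is a context $C[-]=f_{n-1}\star_{n-2}\cdots\star_1(f_1\star_0 - \star_0 g_1)\star_1\cdots\star_{n-2}g_{n-1}$ with $f_k,g_k$ $k$-cells. $P$ is terminating if there is no infinite sequence of composable rewriting steps. **Polygraphs modulo.** An $n$-polygraph modulo $\mathcal{P}=(R,E,S)$ consists of $n$-polygraphs $R$, $E$ with $E_{\leq n-2}=R_{\leq n-2}$, $E_{n-1}\subseteq R_{n-1}$, and a cellular extension $S$ of $R_{n-1}^\ast$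 with $R_n\subseteq S\subseteq {}_ER_E$. Here $E^\top$ is the free $(n,n-1)$-category over $R_{n-1}^\ast$ generated by $E_n$ (all $n$-cells invertible; inverse of $e$ written $e^-$), and ${}_ER_E$ is the set of composable triples $(e,f,e')$ with $e,e'$ $n$-cells of $E^\top$, $f\in R_n^{\ast(1)}$, with source $\partial_-(e)$ and target $\partial_+(e')$ (a rule $f$ is identified with $(1,f,1)$, and a whiskered triple $C[(e,f,e')]$ with $(C[e],C[f],C[e'])$). $S^\ast$ is the free $n$-category over $R_{n-1}^\ast$ generated by $S$; $\|\cdot\|_S$, $\|\cdot\|_E$ are sizes in $S^\ast$ and $E^\top$; $S^{\ast(1)},E^{\top(1)}$ are the cells of size $1$. $\mathcal{P}$ is terminating if the $n$-polygraph $(R_{\leq n-1},{}_ER_E)$ is terminating. **Squares.** A square over a pair $(\mathbf V,\mathbf H)$ of $n$-categories with the same underlying $(n-1)$-category is a quadruple with top $f:u\to v$ and bottom $g:u'\to v'$ in $\mathbf H$, left $e:u\to u'$ and right $e':v\to v'$ in $\mathbf V$ ($n$-cells). A square extension of $(\mathbf V,\mathbf H)$ is a set $\Gamma$ with a map to the set of squares (the boundary); its elements are regarded as square $(n+1)$-cells. A square extension of $\mathcal{P}$ is a square extension of $(E^\top,S^\ast)$. The Peiffer extension $\mathrm{Peiff}(E^\top,S^\ast)$ has one square cell for each square with top $f\star_i v$, bottom $f\star_i v'$, left $u\star_i e$, right $u'\star_i e$, and each with top $w\star_i f'$, bottom $w'\star_i f'$, left $e'\star_i t$, right $e'\star_i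 t'$, where $f:u\to u'$, $f':t\to t'$ are in $S^\ast$, $e:v\to v'$, $e':w\to w'$ in $E^\top$, $0\le i\le n-2$. **Biaction.** If $A$ has top $f$, bottom $g$, left $e$, right $e'$, and $e_1,e_2$ are $n$-cells of $E^\top$ with $\partial_+(e_1)=\partial_-(e)$ and $\partial_-(e_2)=\partial_+(e)$ such that $e_1f$ and $e_2^-g$ (obtained by precomposing the first step) are again $n$-cells of $S^\ast$, then ${}^{e_1}_{e_2}A$ is the square cell with top $e_1f$, bottom $e_2^-g$, left $e_1\star_{n-1} e\star_{n-1} e_2$, right $e'$. $E\rtimes\Gamma$ is the set of all defined ${}^{e_1}_{e_2}A$, $A\in\Gamma$. **The structure $\Gamma^{\curlyvee}$.** This is the free $(n-1)$-category enriched in double categories, with invertible vertical cells, generated by $(E,S,E\rtimes\Gamma\cup\mathrm{Peiff}(E^\top,S^\ast))$: its underlying $(n-1)$-category is $R_{n-1}^\ast$, its vertical $n$-cells are those of $E^\top$, its horizontal $n$-cells are those of $S^\ast$, and its square $(n+1)$-cells are all formal pastings, along common vertical edges ($\diamond^v$) and common horizontal edges ($\diamond^h$), of the generating square cells and their images under contexts of $R_{n-1}^\ast$, identity squares on horizontal and on vertical cells, and inverses with respect to $\diamond^h$ (the inverse of a square with top $f$, bottom $g$, left $e$, right $e'$ has top $g$, bottom $f$, left $e^-$, right $e'^-$), modulo associativity, unit, inverse and middle-four interchange laws (composites $\star_{n-2}$ of squares are determined by functoriality/exchange relations). **Branchings.** An $S$-branching is a triple $(f,e,g)$ with $f,g$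 $n$-cells of $S^\ast$, $f$ nontrivial, $e$ an $n$-cell of $E^\top$, $\partial_-(f)=\partial_-(e)$, $\partial_-(g)=\partial_+(e)$. It is local if $f\in S^{\ast(1)}$ and $\|g\|_S+\|e\|_E=1$. It is $\Gamma$-confluent if there exist $n$-cells $f',g'$ of $S^\ast$, an $n$-cell $e'$ of $E^\top$, and a square $(n+1)$-cell of $\Gamma^{\curlyvee}$ with top $f\star_{n-1}f'$, bottom $g\star_{n-1}g'$, left $e$, right $e'$. $\mathcal{P}$ is $\Gamma$-confluent (resp. locally $\Gamma$-confluent) if every $S$-branching (resp. local $S$-branching) is $\Gamma$-confluent. *)

(* Defs.v *)
From HB Require Import structures.
From mathcomp Require Import all_boot.
From mathcomp Require Import boolp.

Set Implicit Arguments.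
Unset Strict Implicit.
Unset Printing Implicit Defensive.

Reserved Notation "x '*[' i ] y" (at level 40, left associativity,
  format "x  '*[' i ]  y").

Section Quot.
Variables (T : Type) (ok : T -> Prop) (R : T -> T -> Prop).
Hypothesis Rrefl : forall x, ok x -> R x x.
Hypothesis Rsym : forall x y, R x y -> R y x.
Hypothesis Rtrans : forall x y z, R x y -> R y z -> R x z.

Definition okT := {x : {classic T} | `[< ok x >]}.

Definition okR (x y : okT) : bool := `[< R (val x) (val y) >].

Lemma okR_refl : reflexive okR.
Proof. by move=> x; apply/asboolP/Rrefl; case: x => x /= /asboolP. Qed.
Lemma okR_sym : symmetric okR.
Proof. by move=> x y; apply/asboolP/asboolP => /Rsym. Qed.
Lemma okR_trans : transitive okR.
Proof. by move=> y x z /asboolP xy /asboolP yz; apply/asboolP/(Rtrans xy). Qed.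

Canonical okR_equiv := EquivRel okR okR_refl okR_sym okR_trans.

Definition quot := {eq_quot okR_equiv}%qT.

Definition qcls (x : T) (hx : ok x) : quot :=
  (\pi_quot (exist (fun y => `[< ok y >]) x (asboolT hx) : okT))%qT.

Definition qrep (a : quot) : T := val (repr a).

Lemma qrep_ok a : ok (qrep a).
Proof. by rewrite /qrep; case: (repr a) => x /= /asboolP. Qed.

Lemma qrepP x hx : R (qrep (@qcls x hx)) x.
Proof.
rewrite /qrep /qcls.
set y := (exist _ _ _ : okT).
have : (repr (\pi_quot y) == y %[mod quot])%qT by rewrite reprK.
by rewrite eqmodE => /asboolP.
Qed.

Lemma quot_ext a b : R (qrep a) (qrep b) -> a = b.
Proof.
move=> h; rewrite -[a]reprK -[b]reprK; apply/eqP; rewrite eqmodE.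
exact/asboolP.
Qed.

Lemma qcls_eq x y hx hy : R x y -> @qcls x hx = @qcls y hy.
Proof.
move=> h; apply: quot_ext; apply: Rtrans (qrepP hx) _.
by apply: Rtrans h _; apply: Rsym; apply: qrepP.
Qed.

Lemma qcls_inj x y hx hy : @qcls x hx = @qcls y hy -> R x y.
Proof.
move=> h; apply: Rtrans (qrepP hy); apply: Rsym; rewrite -h; exact: qrepP.
Qed.

Lemma qrepK a h : @qcls (qrep a) h = a.
Proof. by apply: quot_ext; apply: qrepP. Qed.

(* [x] if it is well-formed, the junk value [a] otherwise. *)
Definition qclsd (a : quot) (x : T) : quot :=
  if pselect (ok x) is left hx then qcls hx else a.

Lemma qclsdE a x (hx : ok x) : qclsd a x = qcls hx.
Proof. by rewrite /qclsd; case: pselect => // h; apply: qcls_eq; exact: Rrefl. Qed.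

End Quot.

(* Strict globular n-categories, in single-sorted presentation: a [k]-cell is
   identified with the identities on it, so that [cell] contains the cells of
   all dimensions; [sb i x] and [tb i x] are the [i]-dimensional source and
   target of [x], and the cells of dimension at most [k] are the fixed points
   of [sb k]; in an [n]-category every element is an [n]-cell.  [x *[i] y] is
   meaningful only when [composable i x y]. *)
Record ncat (n : nat) := NCat {
  cell :> Type;
  sb : nat -> cell -> cell;
  tb : nat -> cell -> cell;
  star : nat -> cell -> cell -> cell;
  composable := fun i x y => i < n /\ tb i x = sb i y;
  sb_top : forall i x, n <= i -> sb i x = x;
  tb_top : forall i x, n <= i -> tb i x = x;
  sb_sb : forall i j x, sb i (sb j x) = sb (minn i j) x;
  sb_tb : forall i j x, sb i (tb j x) = if i < j then sb i x else tb j x;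
  tb_sb : forall i j x, tb i (sb j x) = if i < j then tb i x else sb j x;
  tb_tb : forall i j x, tb i (tb j x) = tb (minn i j) x;
  sb_star : forall i j x y, composable i x y ->
    sb j (star i x y) = if j <= i then sb j x else star i (sb j x) (sb j y);
  tb_star : forall i j x y, composable i x y ->
    tb j (star i x y) = if j <= i then tb j y else star i (tb j x) (tb j y);
  starA : forall i x y z, composable i x y -> composable i y z ->
    star i x (star i y z) = star i (star i x y) z;
  star1l : forall i x, i < n -> star i (sb i x) x = x;
  star1r : forall i x, i < n -> star i x (tb i x) = x;
  star_exch : forall i j x y z w, i < j ->
    composable j x y -> composable j z w -> composable i x z ->
    star i (star j x y) (star j z w) = star j (star i x z) (star i y w)
}.

Arguments sb {n n0} i x : rename.
Arguments tb {n n0} i x : rename.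
Arguments star {n n0} i x y : rename.
Arguments composable {n n0} i x y : rename.
Notation "x '*[' i ] y" := (star i x y).

Definition discrete (T : Type) : ncat 0.
Proof.
exists T (fun _ x => x) (fun _ x => x) (fun _ x _ => x) => //.
- by move=> i j x; case: ifP.
- by move=> i j x; case: ifP.
- by move=> i j x y [].
- by move=> i j x y [].
Defined.

Definition parallel n (C : ncat n) (u v : C) : Prop :=
  forall i, i < n -> sb i u = sb i v /\ tb i u = tb i v.

(* An (n+1)-category whose underlying n-category is [B]; [src] and [tgt] are
   the codimension-one source and target, [idn u] is the identity on [u]. *)
Record overcat n (B : ncat n) := OverCat {
  total :> ncat n.+1;
  idn : B -> total;
  src : total -> B;
  tgt : total -> B;
  src_idn : forall u, src (idn u) = u;
  tgt_idn : forall u, tgt (idn u) = u;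
  idn_src : forall f, idn (src f) = sb n f;
  idn_tgt : forall f, idn (tgt f) = tb n f;
  idn_sb : forall i u, i < n -> idn (sb i u) = sb i (idn u);
  idn_tb : forall i u, i < n -> idn (tb i u) = tb i (idn u);
  idn_star : forall i u v, composable i u v ->
    idn (u *[i] v) = idn u *[i] idn v
}.

Arguments idn {n B} o u : rename.
Arguments src {n B o} f : rename.
Arguments tgt {n B o} f : rename.

Section OvercatTheory.
Variables (n : nat) (B : ncat n) (O : overcat B).
Implicit Types (u v : B) (f g : O).

Lemma idn_inj : injective (idn O).
Proof. by move=> u v /(congr1 src); rewrite !src_idn. Qed.

Lemma sb_src i f : i < n -> idn O (sb i (src f)) = sb i f.
Proof.
by move=> h; rewrite idn_sb // idn_src sb_sb; congr sb; apply/minn_idPl/ltnW.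
Qed.
Lemma sb_tgt i f : i < n -> idn O (sb i (tgt f)) = sb i f.
Proof. by move=> h; rewrite idn_sb // idn_tgt sb_tb h. Qed.
Lemma tb_src i f : i < n -> idn O (tb i (src f)) = tb i f.
Proof. by move=> h; rewrite idn_tb // idn_src tb_sb h. Qed.
Lemma tb_tgt i f : i < n -> idn O (tb i (tgt f)) = tb i f.
Proof.
by move=> h; rewrite idn_tb // idn_tgt tb_tb; congr tb; apply/minn_idPl/ltnW.
Qed.

Lemma parallel_bd f : parallel (src f) (tgt f).
Proof.
by move=> i h; split; apply: idn_inj; rewrite ?sb_src ?sb_tgt ?tb_src ?tb_tgt.
Qed.

Lemma composable_src i f g : i < n -> composable i f g ->
  composable i (src f) (src g).
Proof.
move=> h [_ e]; split=> //; apply: idn_inj; by rewrite tb_src // sb_src.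
Qed.
Lemma composable_tgt i f g : i < n -> composable i f g ->
  composable i (tgt f) (tgt g).
Proof.
move=> h [_ e]; split=> //; apply: idn_inj; by rewrite tb_tgt // sb_tgt.
Qed.

Lemma composable_top f g : tgt f = src g -> composable n f g.
Proof. by move=> h; split=> //; rewrite -idn_tgt -idn_src h. Qed.

Lemma composable_low i f g : i < n -> tb i (src f) = sb i (src g) ->
  composable i f g.
Proof. by move=> h e; split; [exact: ltnW | rewrite -tb_src // -sb_src // e]. Qed.

Lemma src_star i f g : i < n -> composable i f g ->
  src (f *[i] g) = src f *[i] src g.
Proof.
move=> h c; apply: idn_inj; rewrite idn_star; last exact: composable_src.
by rewrite !idn_src sb_star // leqNgt h.
Qed.
Lemma tgt_star i f g : i < n -> composable i f g ->
  tgt (f *[i] g) = tgt f *[i] tgt g.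
Proof.
move=> h c; apply: idn_inj; rewrite idn_star; last exact: composable_tgt.
by rewrite !idn_tgt tb_star // leqNgt h.
Qed.

Lemma src_comp f g : tgt f = src g -> src (f *[n] g) = src f.
Proof.
move=> h; apply: idn_inj; rewrite !idn_src sb_star ?leqnn //.
exact: composable_top.
Qed.
Lemma tgt_comp f g : tgt f = src g -> tgt (f *[n] g) = tgt g.
Proof.
move=> h; apply: idn_inj; rewrite !idn_tgt tb_star ?leqnn //.
exact: composable_top.
Qed.

Lemma comp1f f : idn O (src f) *[n] f = f.
Proof. by rewrite idn_src star1l. Qed.
Lemma compf1 f : f *[n] idn O (tgt f) = f.
Proof. by rewrite idn_tgt star1r. Qed.
Lemma compA f g h : tgt f = src g -> tgt g = src h ->
  f *[n] (g *[n] h) = f *[n] g *[n] h.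
Proof. by move=> c d; rewrite starA //; apply: composable_top. Qed.

Definition is_inverse f g : Prop :=
  [/\ tgt f = src g, tgt g = src f,
      f *[n] g = idn O (src f) & g *[n] f = idn O (tgt f)].

Definition invertible f : Prop := exists g, is_inverse f g.

(* [f^-]; junk when [f] is not invertible. *)
Definition cinv f : O :=
  if pselect (invertible f) is left h then projT1 (cid h) else f.

Lemma cinvP f : invertible f -> is_inverse f (cinv f).
Proof. by rewrite /cinv; case: pselect => // h _; case: (cid h). Qed.

End OvercatTheory.

Arguments cinv {n B O} f.

Record cellext n (C : ncat n) := CellExt {
  gens :> Type;
  gsrc : gens -> C;
  gtgt : gens -> C;
  gpar : forall x, parallel (gsrc x) (gtgt x)
}.

Section Pres.
Variables (n : nat) (C : ncat n) (X : cellext C).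

Inductive raw : Type :=
| Gen of X
| Idt of C
| Comp of nat & raw & raw.

Fixpoint rsrc (f : raw) : C :=
  match f with
  | Gen x => gsrc x
  | Idt u => u
  | Comp i f g => if i < n then rsrc f *[i] rsrc g else rsrc f
  end.

Fixpoint rtgt (f : raw) : C :=
  match f with
  | Gen x => gtgt x
  | Idt u => u
  | Comp i f g => if i < n then rtgt f *[i] rtgt g else rtgt g
  end.

(* For [i = n] the last condition reads [rtgt f = rsrc g]. *)
Fixpoint rwf (f : raw) : Prop :=
  match f with
  | Comp i f g => [/\ rwf f, rwf g, i <= n & tb i (rtgt f) = sb i (rsrc g)]
  | _ => True
  end.

Definition rsb i f := if i <= n then Idt (sb i (rsrc f)) else f.
Definition rtb i f := if i <= n then Idt (tb i (rtgt f)) else f.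

Fixpoint ngen (f : raw) : nat :=
  match f with
  | Gen _ => 1
  | Idt _ => 0
  | Comp _ f g => ngen f + ngen g
  end.

Variable ax : raw -> raw -> Prop.

(* The congruence generated by the axioms of (n+1)-categories and [ax];
   [Idt u] is the identity on the n-cell [u]. *)
Inductive req : raw -> raw -> Prop :=
| req_refl f : rwf f -> req f f
| req_sym f g : req f g -> req g f
| req_trans f g h : req f g -> req g h -> req f h
| req_comp i f f' g g' : req f f' -> req g g' -> rwf (Comp i f g) ->
    req (Comp i f g) (Comp i f' g')
| req_assoc i f g h : rwf (Comp i f g) -> rwf (Comp i g h) ->
    req (Comp i f (Comp i g h)) (Comp i (Comp i f g) h)
| req_1l i f : rwf f -> i <= n -> req (Comp i (rsb i f) f) f
| req_1r i f : rwf f -> i <= n -> req (Comp i f (rtb i f)) f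
| req_exch i j f g h k : i < j ->
    rwf (Comp j f g) -> rwf (Comp j h k) -> rwf (Comp i f h) ->
    req (Comp i (Comp j f g) (Comp j h k)) (Comp j (Comp i f h) (Comp i g k))
| req_idt i u v : composable i u v ->
    req (Idt (u *[i] v)) (Comp i (Idt u) (Idt v))
| req_ax f g : rwf f -> rwf g -> rsrc f = rsrc g -> rtgt f = rtgt g ->
    ax f g -> req f g.

Lemma rpar f : rwf f -> parallel (rsrc f) (rtgt f).
Proof.
elim: f => [x|u|k f IHf g IHg] //=; first by move=> _; exact: gpar.
case=> wf wg kn e i hi.
have [hf1 hf2] := IHf wf i hi; have [hg1 hg2] := IHg wg i hi.
case: ltnP => hk; last first.
  have ek : k = n by apply/eqP; rewrite eqn_leq kn.
  move: e; rewrite ek (tb_top _ (leqnn n)) (sb_top _ (leqnn n)) => e.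
  by rewrite hf1 hf2 e.
have cs : composable k (rsrc f) (rsrc g).
  by split=> //; rewrite -e (IHf wf k hk).2.
have ct : composable k (rtgt f) (rtgt g).
  by split=> //; rewrite e (IHg wg k hk).1.
rewrite !sb_star // !tb_star //.
by case: ifP => _; rewrite ?hf1 ?hg1 ?hf2 ?hg2.
Qed.

Lemma rcs i f g : i < n -> rwf (Comp i f g) -> composable i (rsrc f) (rsrc g).
Proof. by move=> h [wf wg _ e]; split=> //; rewrite -e (rpar wf h).2. Qed.
Lemma rct i f g : i < n -> rwf (Comp i f g) -> composable i (rtgt f) (rtgt g).
Proof. by move=> h [wf wg _ e]; split=> //; rewrite e (rpar wg h).1. Qed.

Lemma eq_top i : i <= n -> (i < n) = false -> i = n.
Proof. by move=> h /negbT; rewrite -leqNgt => h'; apply/eqP; rewrite eqn_leq h. Qed.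

Lemma req_ok f g : req f g ->
  [/\ rwf f, rwf g, rsrc f = rsrc g & rtgt f = rtgt g].
Proof.
elim=> {f g} //.
- by move=> f g _ [? ? -> ->].
- by move=> f g h _ [? ? -> ->] _ [? ? -> ->].
- move=> i f f' g g' _ [wf wf' sf tf] _ [wg wg' sg tg] w.
  case: (w) => _ _ hi e; split=> //=; last by rewrite tf tg.
    by split=> //; rewrite -tf -sg.
  by rewrite sf sg.
- move=> i f g h wfg wgh; case: (wfg) => wf wg hi e; case: (wgh) => _ wh _ e'.
  case hin: (i < n); last first.
    have ei := eq_top hi hin; subst i; rewrite /= !ltnn; by split.
  rewrite /= !hin; split.
  + by split=> //; rewrite sb_star ?leqnn //; exact: rcs.
  + by split=> //; rewrite tb_star ?leqnn //; exact: rct.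
  + by rewrite starA //; exact: rcs.
  + by rewrite starA //; exact: rct.
- move=> i f wf hi; rewrite /rsb hi /=; case hin: (i < n).
    split=> //; rewrite ?star1l //; first by split=> //; rewrite tb_sb ltnn.
    by rewrite (rpar wf hin).1 star1l.
  have ei := eq_top hi hin; subst i; rewrite !sb_top // tb_top //.
- move=> i f wf hi; rewrite /rtb hi /=; case hin: (i < n).
    split=> //; rewrite ?star1r //; first by split=> //; rewrite sb_tb ltnn.
    by rewrite -(rpar wf hin).2 star1r.
  have ei := eq_top hi hin; subst i; rewrite !tb_top // sb_top //.
- move=> i j f g h k ij wfg whk wfh.
  case: (wfg) => wf wg hj e1; case: (whk) => wh wk _ e2.
  case: (wfh) => _ _ hi e3.
  have hin : i < n by exact: leq_trans hj.
  have cs := rcs hin wfh; have ct := rct hin wfh.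
  have efg : tb i (rtgt f) = tb i (rtgt g) /\ sb i (rsrc g) = sb i (rsrc f).
    have := congr1 (tb i) e1; have := congr1 (sb i) e1.
    rewrite sb_tb sb_sb tb_sb tb_tb ij (minn_idPl (ltnW ij)) => <- ->.
    by rewrite (rpar wf hin).1 (rpar wg hin).2.
  have ehk : sb i (rsrc h) = sb i (rsrc k).
    have := congr1 (sb i) e2.
    by rewrite sb_tb sb_sb ij (minn_idPl (ltnW ij)) => <-; rewrite (rpar wh hin).1.
  have wgk : rwf (Comp i g k) by split=> //; rewrite -efg.1 e3.
  have csk := rcs hin wgk; have ctk := rct hin wgk.
  rewrite /= hin; case hjn: (j < n).
    have cfg := rcs hjn wfg; have tfg := rct hjn wfg.
    have chk := rcs hjn whk; have thk := rct hjn whk.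
    split.
    + split=> //; rewrite tb_star // sb_star // (ltnW ij).
      by rewrite -efg.1.
    + split=> //.
      by rewrite tb_star // sb_star // leqNgt ij /= e1 e2.
    + by rewrite star_exch.
    + by rewrite star_exch //; split.
  have ej := eq_top hj hjn; subst j; split=> //.
  + by split=> //; rewrite -efg.1.
  + split=> //; rewrite tb_top // sb_top //.
    by move: e1 e2; rewrite !tb_top // !sb_top // => -> ->.
- move=> i u v [hi e] /=; rewrite hi; split=> //; split=> //; exact: ltnW.
Qed.

Lemma req_rwfl f g : req f g -> rwf f. Proof. by case/req_ok. Qed.

Definition pcell : Type := quot req_refl req_sym req_trans.

Definition pcls f (wf : rwf f) : pcell := qcls req_refl req_sym req_trans wf.
Definition prep (a : pcell) : raw := qrep a.

Lemma prep_wf a : rwf (prep a). Proof. exact: qrep_ok. Qed.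

Lemma prepP f wf : req (prep (@pcls f wf)) f. Proof. exact: qrepP. Qed.

Lemma pcell_ext a b : req (prep a) (prep b) -> a = b. Proof. exact: quot_ext. Qed.

Definition psrc (a : pcell) : C := rsrc (prep a).
Definition ptgt (a : pcell) : C := rtgt (prep a).

Lemma psrc_cls f wf : psrc (@pcls f wf) = rsrc f.
Proof. by case: (req_ok (prepP wf)). Qed.
Lemma ptgt_cls f wf : ptgt (@pcls f wf) = rtgt f.
Proof. by case: (req_ok (prepP wf)). Qed.

Definition pidn (u : C) : pcell := @pcls (Idt u) I.

Lemma pidnP u : req (prep (pidn u)) (Idt u). Proof. exact: prepP. Qed.

Definition psb i (a : pcell) : pcell :=
  if i <= n then pidn (sb i (psrc a)) else a.
Definition ptb i (a : pcell) : pcell :=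
  if i <= n then pidn (tb i (ptgt a)) else a.

Definition pstar i (a b : pcell) : pcell :=
  qclsd a (Comp i (prep a) (prep b)).

Definition pcomposable i (a b : pcell) := i < n.+1 /\ ptb i a = psb i b.

Lemma psrc_idn u : psrc (pidn u) = u. Proof. exact: psrc_cls. Qed.
Lemma ptgt_idn u : ptgt (pidn u) = u. Proof. exact: ptgt_cls. Qed.

Lemma pidn_inj : injective pidn.
Proof. by move=> u v /(congr1 psrc); rewrite !psrc_idn. Qed.

Lemma pcomposableE i a b : pcomposable i a b <-> rwf (Comp i (prep a) (prep b)).
Proof.
rewrite /pcomposable /ptb /psb ltnS; split.
  by case=> hi; rewrite hi => /pidn_inj e; split=> //; apply: prep_wf.
by case=> _ _ hi e; rewrite hi; split=> //; congr pidn.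
Qed.

Lemma pstarP i a b : pcomposable i a b ->
  req (prep (pstar i a b)) (Comp i (prep a) (prep b)).
Proof.
move=> /pcomposableE h; rewrite /pstar.
rewrite (@qclsdE _ _ _ req_refl req_sym req_trans _ _ h); exact: prepP.
Qed.

Lemma psrc_star i a b : pcomposable i a b ->
  psrc (pstar i a b) = if i < n then psrc a *[i] psrc b else psrc a.
Proof. by move=> /pstarP /req_ok []. Qed.
Lemma ptgt_star i a b : pcomposable i a b ->
  ptgt (pstar i a b) = if i < n then ptgt a *[i] ptgt b else ptgt b.
Proof. by move=> /pstarP /req_ok []. Qed.

Lemma ppar a : parallel (psrc a) (ptgt a). Proof. exact/rpar/prep_wf. Qed.

Lemma psbP i a : i <= n -> req (prep (psb i a)) (rsb i (prep a)).
Proof. by move=> h; rewrite /psb /rsb h; apply: pidnP. Qed.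
Lemma ptbP i a : i <= n -> req (prep (ptb i a)) (rtb i (prep a)).
Proof. by move=> h; rewrite /ptb /rtb h; apply: pidnP. Qed.

Lemma pcs i a b : i < n -> pcomposable i a b -> composable i (psrc a) (psrc b).
Proof. by move=> h /pcomposableE; apply: rcs. Qed.
Lemma pct i a b : i < n -> pcomposable i a b -> composable i (ptgt a) (ptgt b).
Proof. by move=> h /pcomposableE; apply: rct. Qed.

Lemma pidn_star i u v : composable i u v ->
  pidn (u *[i] v) = pstar i (pidn u) (pidn v).
Proof.
move=> c; case: (c) => h e; apply: pcell_ext.
have pc : pcomposable i (pidn u) (pidn v).
  by split; [exact: ltnW | rewrite /ptb /psb ptgt_idn psrc_idn (ltnW h) e].
apply: req_trans (pidnP _) _; apply: req_trans (req_idt c) _; apply: req_sym.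
apply: req_trans (pstarP pc) _; apply: req_comp (pidnP _) (pidnP _) _.
exact/pcomposableE.
Qed.

Lemma psb_top i (x : pcell) : n < i -> psb i x = x.
Proof.
move=> h.
by rewrite /psb leqNgt h.
Qed.

Lemma ptb_top i (x : pcell) : n < i -> ptb i x = x.
Proof.
move=> h.
by rewrite /ptb leqNgt h.
Qed.

Lemma psb_sb i j (x : pcell) : psb i (psb j x) = psb (minn i j) x.
Proof.
rewrite /psb; case: (leqP j n) => hj.
  case: (leqP i n) => hi; rewrite ?psrc_idn.
    by rewrite geq_min hi sb_sb.
  by rewrite (minn_idPr (ltnW (leq_ltn_trans hj hi))) hj.
case: (leqP i n) => hi; first by rewrite geq_min hi (minn_idPl (ltnW (leq_ltn_trans hi hj))).
by rewrite geq_min (leqNgt i) (leqNgt j) hi hj.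
Qed.

Lemma psb_tb i j (x : pcell) : psb i (ptb j x) = if i < j then psb i x else ptb j x.
Proof.
rewrite /psb /ptb; case: (leqP j n) => hj.
  case: (leqP i n) => hi.
    rewrite psrc_idn sb_tb; case: ifP => ij //.
    by rewrite (ppar x (leq_trans ij hj)).1.
  by rewrite ltnNge (ltnW (leq_ltn_trans hj hi)).
by case: (leqP i n) => hi; [rewrite (leq_ltn_trans hi hj) | case: ifP].
Qed.

Lemma ptb_sb i j (x : pcell) : ptb i (psb j x) = if i < j then ptb i x else psb j x.
Proof.
rewrite /psb /ptb; case: (leqP j n) => hj.
  case: (leqP i n) => hi.
    rewrite ptgt_idn tb_sb; case: ifP => ij //.
    by rewrite (ppar x (leq_trans ij hj)).2.
  by rewrite ltnNge (ltnW (leq_ltn_trans hj hi)).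
by case: (leqP i n) => hi; [rewrite (leq_ltn_trans hi hj) | case: ifP].
Qed.

Lemma ptb_tb i j (x : pcell) : ptb i (ptb j x) = ptb (minn i j) x.
Proof.
rewrite /ptb; case: (leqP j n) => hj.
  case: (leqP i n) => hi; rewrite ?ptgt_idn.
    by rewrite geq_min hi tb_tb.
  by rewrite (minn_idPr (ltnW (leq_ltn_trans hj hi))) hj.
case: (leqP i n) => hi; first by rewrite geq_min hi (minn_idPl (ltnW (leq_ltn_trans hi hj))).
by rewrite geq_min (leqNgt i) (leqNgt j) hi hj.
Qed.

Lemma psb_star i j (x y : pcell) : pcomposable i x y ->
  psb j (pstar i x y) = if j <= i then psb j x else pstar i (psb j x) (psb j y).
Proof.
move=> c.
case: (c) => hi e; rewrite /psb psrc_star //.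
case: (leqP j n) => hj; last by rewrite leqNgt (leq_trans hi hj).
case hin: (i < n).
  have cs := pcs hin c; rewrite sb_star //; case: ifP => ji //.
  rewrite pidn_star //; split=> //.
  by rewrite tb_sb sb_sb ltnNge ji /= (minn_idPl _) ?cs.2 // ltnW // ltnNge ji.
have ei := eq_top hi hin; subst i; by rewrite hj.
Qed.

Lemma ptb_star i j (x y : pcell) : pcomposable i x y ->
  ptb j (pstar i x y) = if j <= i then ptb j y else pstar i (ptb j x) (ptb j y).
Proof.
move=> c.
case: (c) => hi e; rewrite /ptb ptgt_star //.
case: (leqP j n) => hj; last by rewrite leqNgt (leq_trans hi hj).
case hin: (i < n).
  have ct := pct hin c; rewrite tb_star //; case: ifP => ji //.
  rewrite pidn_star //; split=> //.
  by rewrite sb_tb tb_tb ltnNge ji /= (minn_idPl _) ?ct.2 // ltnW // ltnNge ji.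
have ei := eq_top hi hin; subst i; by rewrite hj.
Qed.

Lemma pstarA i (x y z : pcell) : pcomposable i x y -> pcomposable i y z ->
  pstar i x (pstar i y z) = pstar i (pstar i x y) z.
Proof.
move=> c d.
have [/pcomposableE w /pcomposableE w'] := (c, d).
have [k1 k2 e1 e2] := req_ok (req_assoc w w').
have xy : req (Comp i (prep (pstar i x y)) (prep z))
              (Comp i (Comp i (prep x) (prep y)) (prep z)).
  apply: req_sym; apply: req_comp => //.
    by apply: req_sym; apply: pstarP.
  exact/req_refl/prep_wf.
have yz : req (Comp i (prep x) (prep (pstar i y z)))
              (Comp i (prep x) (Comp i (prep y) (prep z))).
  apply: req_sym; apply: req_comp => //.
    exact/req_refl/prep_wf.
  by apply: req_sym; apply: pstarP.
apply: pcell_ext; apply: req_trans (pstarP _) _.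
  exact/pcomposableE/(req_rwfl yz).
apply: req_trans yz _; apply: req_trans (req_assoc w w') _.
apply: req_sym; apply: (req_trans (pstarP _) xy).
exact/pcomposableE/(req_rwfl xy).
Qed.

Lemma pstar1l i (x : pcell) : i < n.+1 -> pstar i (psb i x) x = x.
Proof.
rewrite ltnS => hi; apply: pcell_ext.
have h := req_1l (prep_wf x) hi.
have hc : req (Comp i (prep (psb i x)) (prep x)) (prep x).
  apply: (req_trans _ h); apply: req_sym; apply: req_comp; last exact: req_rwfl h.
    exact/req_sym/psbP.
  exact/req_refl/prep_wf.
apply: (req_trans (pstarP _) hc); exact/pcomposableE/(req_rwfl hc).
Qed.

Lemma pstar1r i (x : pcell) : i < n.+1 -> pstar i x (ptb i x) = x.
Proof.
rewrite ltnS => hi; apply: pcell_ext.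
have h := req_1r (prep_wf x) hi.
have hc : req (Comp i (prep x) (prep (ptb i x))) (prep x).
  apply: (req_trans _ h); apply: req_sym; apply: req_comp; last exact: req_rwfl h.
    exact/req_refl/prep_wf.
  exact/req_sym/ptbP.
apply: (req_trans (pstarP _) hc); exact/pcomposableE/(req_rwfl hc).
Qed.

Lemma pstar_exch i j (x y z w : pcell) : i < j ->
  pcomposable j x y -> pcomposable j z w -> pcomposable i x z ->
  pstar i (pstar j x y) (pstar j z w) = pstar j (pstar i x z) (pstar i y w).
Proof.
move=> ij cxy czw cxz.
have [/pcomposableE wxy /pcomposableE wzw] := (cxy, czw).
have /pcomposableE wxz := cxz.
have hr := req_exch ij wxy wzw wxz.
have [k1 k2 _ _] := req_ok hr.
have cyw : pcomposable i y w by apply/pcomposableE; case: k2.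
have l : req (Comp i (prep (pstar j x y)) (prep (pstar j z w)))
             (Comp i (Comp j (prep x) (prep y)) (Comp j (prep z) (prep w))).
  by apply: req_sym; apply: req_comp => //; apply: req_sym; apply: pstarP.
have r : req (Comp j (prep (pstar i x z)) (prep (pstar i y w)))
             (Comp j (Comp i (prep x) (prep z)) (Comp i (prep y) (prep w))).
  by apply: req_sym; apply: req_comp => //; apply: req_sym; apply: pstarP.
apply: pcell_ext; apply: req_trans (pstarP _) _.
  exact/pcomposableE/(req_rwfl l).
apply: req_trans l _; apply: req_trans hr _; apply: req_sym.
apply: (req_trans (pstarP _) r); exact/pcomposableE/(req_rwfl r).
Qed.

Definition presN : ncat n.+1 :=
  NCat psb_top ptb_top psb_sb psb_tb ptb_sb ptb_tb psb_star ptb_star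
    pstarA pstar1l pstar1r pstar_exch.

Definition pres : overcat C.
Proof.
exists presN pidn psrc ptgt => /=.
- exact: psrc_idn.
- exact: ptgt_idn.
- by move=> f; rewrite /psb leqnn sb_top.
- by move=> f; rewrite /ptb leqnn tb_top.
- by move=> i u h; rewrite /psb ltnW // psrc_idn.
- by move=> i u h; rewrite /ptb ltnW // ptgt_idn.
- exact: pidn_star.
Defined.

Definition pgen (x : X) : pres := @pcls (Gen x) I.

Lemma psize_ex (a : pres) :
  exists k, `[< exists f (wf : rwf f), @pcls f wf = a /\ ngen f = k >].
Proof.
exists (ngen (prep a)); apply/asboolP; exists (prep a), (prep_wf a).
by split=> //; apply: qrepK.
Qed.

(* Least number of generators in a term representing [a]; in a free category
   all the terms representing [a] have the same number of generators. *)
Definition psize (a : pres) : nat := ex_minn (psize_ex a).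

Lemma psizeE f wf : (forall g h, ax g h -> ngen g = ngen h) ->
  psize (@pcls f wf) = ngen f.
Proof.
move=> hax; have inv g h : req g h -> ngen g = ngen h.
  elim=> {g h} //=.
  - by move=> g h k _ -> _ ->.
  - by move=> i g g' h h' _ -> _ ->.
  - by move=> *; rewrite addnA.
  - by move=> i g _ hi; rewrite /rsb hi.
  - by move=> i g _ hi; rewrite /rtb hi /= addn0.
  - by move=> *; rewrite addnACA.
  - by move=> g h _ _ _ _; apply: hax.
rewrite /psize; case: ex_minnP => k /asboolP[g [wg [e <-]]] _.
exact/inv/(qcls_inj e).
Qed.

End Pres.

Arguments Idt {n C X} u.
Arguments Gen {n C X} x.
Arguments Comp {n C X} i f g.

Definition freecat n (C : ncat n) (X : cellext C) : overcat C :=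
  pres (fun _ _ : raw X => False).

Definition fgen n (C : ncat n) (X : cellext C) (x : X) : freecat X := pgen _ x.
Definition fsize n (C : ncat n) (X : cellext C) (f : freecat X) : nat := psize f.

(* Free (n+1,n)-category: [C[X + X^-]] modulo [x x^- = 1] and [x^- x = 1];
    the generator [(x, false)] is [x^-]. *)
Definition dbl n (C : ncat n) (X : cellext C) : cellext C.
Proof.
exists (X * bool)%type (fun x => if x.2 then gsrc x.1 else gtgt x.1)
  (fun x => if x.2 then gtgt x.1 else gsrc x.1) => -[x []] i hi /=.
- exact: gpar.
- by case: (gpar x hi) => -> ->.
Defined.

Definition dgen n (C : ncat n) (X : cellext C) (x : X) (b : bool) : dbl X := (x, b).

Inductive inv_ax n (C : ncat n) (X : cellext C) : raw (dbl X) -> raw (dbl X) -> Prop :=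
  InvAx (x : X) (b : bool) :
    inv_ax (Comp n (Gen (dgen x b)) (Gen (dgen x (~~ b))))
           (Idt (gsrc (dgen x b))).

Definition freegpd n (C : ncat n) (X : cellext C) : overcat C :=
  pres (@inv_ax n C X).

Definition gsize n (C : ncat n) (X : cellext C) (e : freegpd X) : nat := psize e.

Section Freegpd.
Variables (n : nat) (C : ncat n) (X : cellext C).
Let req' := req (@inv_ax n C X).
Let cls (f : raw (dbl X)) (wf : rwf f) : freegpd X := pcls _ wf.

Lemma cls_comp i f g (wf : rwf f) (wg : rwf g) (w : rwf (Comp i f g)) :
  composable i (cls wf) (cls wg) /\ cls w = cls wf *[i] cls wg.
Proof.
have h : req' (Comp i (prep (cls wf)) (prep (cls wg))) (Comp i f g).
  by apply: req_sym; apply: req_comp w; apply: req_sym; apply: prepP.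
have c : composable i (cls wf) (cls wg) by apply/pcomposableE/(req_rwfl h).
split=> //; apply: pcell_ext; apply: req_trans (prepP _ w) _; apply: req_sym.
exact: req_trans (pstarP c) h.
Qed.

Lemma freegpd_inv (e : freegpd X) : invertible e.
Proof.
have [f [wf <-]] : exists f wf, @cls f wf = e.
  by exists (prep e), (prep_wf e); apply: qrepK.
elim: f wf => [[x b]|u|i f IHf g IHg] wf {e}.
- have c b' : req' (Comp n (Gen (dgen x b')) (Gen (dgen x (~~ b'))))
                (Idt (gsrc (dgen x b'))).
    apply: req_ax; last exact: InvAx.
    + by split=> //=; rewrite tb_top ?sb_top //; case: b'.
    + by [].
    + by rewrite /= ltnn.
    + by rewrite /= ltnn; case: b'.
  have st b' : src (pgen (@inv_ax n C X) (dgen x b')) = gsrc (dgen x b').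
    exact: psrc_cls.
  have tg b' : tgt (pgen (@inv_ax n C X) (dgen x b')) = gtgt (dgen x b').
    exact: ptgt_cls.
  have E b' : pgen (@inv_ax n C X) (dgen x b') *[n] pgen _ (dgen x (~~ b'))
    = idn (freegpd X) (gsrc (dgen x b')).
    have w := req_rwfl (c b').
    have [_ <-] := @cls_comp n (Gen _) (Gen _) I I w.
    by apply: qcls_eq; apply: c.
  have -> : cls wf = pgen (@inv_ax n C X) (dgen x b) by exact: qcls_eq (req_refl _ wf).
  exists (pgen _ (dgen x (~~ b))); split; rewrite ?st ?tg.
  + by case: b {wf}.
  + by case: b {wf}.
  + by rewrite E.
  + by have := E (~~ b); rewrite negbK => ->; case: b {wf}.
- exists (idn _ u).
  have -> : cls wf = idn (freegpd X) u by exact: qcls_eq (req_refl _ wf).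
  have := @comp1f _ _ (freegpd X) (idn _ u).
  by split; rewrite !(src_idn, tgt_idn) // in H *.
- have [wf1 wg1 hi e] := wf; have [c ->] := cls_comp wf1 wg1 wf.
  have [f' [f1 f2 f3 f4]] := IHf wf1; have [g' [g1 g2 g3 g4]] := IHg wg1.
  set F := cls wf1 in c f1 f2 f3 f4 *; set G := cls wg1 in c g1 g2 g3 g4 *.
  case hin: (i < n); last first.
    have ei := eq_top hi hin; subst i.
    have efg : tgt F = src G.
      by case: c => _; rewrite -idn_tgt -idn_src => /idn_inj.
    have h1 : tgt g' = src f' by rewrite g2 -efg.
    exists (g' *[n] f'); split; rewrite ?src_comp ?tgt_comp //.
    + by rewrite compA ?tgt_comp // -(compA efg g1) g3 -efg compf1 f3.
    + have h2 : tgt f' = src (F *[n] G) by rewrite src_comp.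
      by rewrite -(compA h1 h2) (compA f2 efg) f4 efg comp1f g4.
  have c' : composable i f' g'.
    apply: composable_low => //; rewrite -f1 -g1.
    by case: (composable_tgt hin c).
  exists (f' *[i] g'); split.
  + by rewrite tgt_star // src_star // f1 g1.
  + by rewrite tgt_star // src_star // f2 g2.
  + rewrite -star_exch //; try exact: composable_top.
    by rewrite f3 g3 src_star // idn_star //; exact: composable_src.
  + rewrite -star_exch //; try exact: composable_top.
    by rewrite f4 g4 tgt_star // idn_star //; exact: composable_tgt.
Qed.

End Freegpd.

Section Whisker.
Variables (n : nat) (B : ncat n).

(* The context [f_n *[n-1] (... (f_1 *[0] - *[0] g_1) ...) *[n-1] g_n] on
   (n+1)-cells over [B] is the sequence [(f_1, g_1), ..., (f_n, g_n)]. *)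
Definition whisker := seq (B * B).

Fixpoint plug (D : Type) (op : nat -> D -> D -> D) (id : B -> D)
    (i : nat) (c : whisker) (x : D) : D :=
  if c is (f, g) :: c' then plug op id i.+1 c' (op i (op i (id f) x) (id g))
  else x.

(* [c] can be applied to the (n+1)-cells with source [u]. *)
Fixpoint plug_ok (i : nat) (c : whisker) (u : B) : Prop :=
  if c is (f, g) :: c' then
    [/\ sb i.+1 f = f, sb i.+1 g = g, composable i f u, composable i u g &
        plug_ok i.+1 c' (f *[i] u *[i] g)]
  else i = n.

Definition whisk_ok (c : whisker) (u : B) : Prop := plug_ok 0 c u.

Definition whisk (O : overcat B) (c : whisker) (x : O) : O :=
  plug star (idn O) 0 c x.

Definition rwhisk (X : cellext B) (c : whisker) (x : raw X) : raw X :=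
  plug Comp Idt 0 c x.

Lemma par_whisk i (f u v g : B) : parallel u v ->
  composable i f u -> composable i u g ->
  [/\ composable i f v, composable i v g &
      parallel (f *[i] u *[i] g) (f *[i] v *[i] g)].
Proof.
move=> p [hi e1] [_ e2].
have [p1 p2] := p i hi.
have c1 : composable i f u by []. have c2 : composable i u g by [].
have c3 : composable i f v by split; rewrite // -p1.
have c4 : composable i v g by split; rewrite // -p2.
have c5 : composable i (f *[i] u) g by split; rewrite // tb_star // leqnn.
have c6 : composable i (f *[i] v) g by split; rewrite // tb_star // leqnn -p2.
split=> // j hj; have [q1 q2] := p j hj.
by rewrite !sb_star // !tb_star //; case: (j <= i); rewrite ?q1 ?q2.
Qed.

Lemma plug_ok_par i c u v : parallel u v -> plug_ok i c u -> plug_ok i c v.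
Proof.
elim: c i u v => //= -[f g] c IH i u v p [d1 d2 c1 c2 h].
have [c3 c4 p'] := par_whisk p c1 c2.
by split=> //; apply: IH h.
Qed.

Lemma src_plug (O : overcat B) i c (x : O) : plug_ok i c (src x) ->
  src (plug star (idn O) i c x) = plug star id i c (src x).
Proof.
elim: c i x => //= -[f g] c IH i x [_ _ c1 c2 h].
case: (c1) (c2) => hi e1 [_ e2].
have k1 : composable i (idn O f) x by apply: composable_low; rewrite ?tgt_idn ?src_idn.
have k2 : composable i (idn O f *[i] x) (idn O g).
  by apply: composable_low; rewrite // src_star // !src_idn tb_star // leqnn.
by rewrite IH src_star // src_star // !src_idn.
Qed.

Lemma tgt_plug (O : overcat B) i c (x : O) : plug_ok i c (src x) ->
  tgt (plug star (idn O) i c x) = plug star id i c (tgt x).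
Proof.
elim: c i x => //= -[f g] c IH i x [_ _ c1 c2 h].
case: (c1) (c2) => hi e1 [_ e2].
have k1 : composable i (idn O f) x by apply: composable_low; rewrite ?tgt_idn ?src_idn.
have k2 : composable i (idn O f *[i] x) (idn O g).
  by apply: composable_low; rewrite // src_star // !src_idn tb_star // leqnn.
rewrite IH; first by rewrite tgt_star // tgt_star // !tgt_idn.
by rewrite src_star // src_star // !src_idn.
Qed.

End Whisker.

(* The type of k-polygraphs together with their free k-categories, built
   simultaneously by recursion on k. *)
Record stage (n : nat) := Stage { obj : Type; real : obj -> ncat n }.

Fixpoint pstage (n : nat) : stage n :=
  match n with
  | 0 => Stage discrete
  | k.+1 => Stage (fun P : {P : obj (pstage k) & cellext (real P)} =>
                     total (freecat (projT2 P)))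
  end.

Definition pol (n : nat) : Type := obj (pstage n).

Definition pstars n (P : pol n) : ncat n := real P.

Definition low n (P : pol n.+1) : pol n := projT1 P.
Definition topext n (P : pol n.+1) : cellext (pstars (low P)) := projT2 P.
Definition addext n (P : pol n) (X : cellext (pstars P)) : pol n.+1 :=
  existT _ P X.

Definition terminating n (P : pol n.+1) : Prop :=
  ~ exists f : nat -> freecat (topext P),
      forall k, fsize (f k) = 1 /\ tgt (f k) = src (f k.+1).

Definition subext n (C : ncat n) (X : cellext C) (A : X -> Prop) : cellext C :=
  @CellExt n C {x : X | A x} (fun x => gsrc (sval x)) (fun x => gtgt (sval x))
    (fun x => gpar (sval x)).

Section Subext.
Variables (n : nat) (C : ncat n) (X : cellext C) (A : X -> Prop).

Fixpoint rincl (f : raw (subext A)) : raw X :=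
  match f with
  | Gen x => Gen (sval x : X)
  | Idt u => Idt u
  | Comp i f g => Comp i (rincl f) (rincl g)
  end.

Lemma rincl_src f : rsrc (rincl f) = rsrc f.
Proof. by elim: f => //= i f -> g ->. Qed.
Lemma rincl_tgt f : rtgt (rincl f) = rtgt f.
Proof. by elim: f => //= i f -> g ->. Qed.
Lemma rincl_wf f : rwf f -> rwf (rincl f).
Proof.
elim: f => //= i f IHf g IHg [wf wg hi e].
by split; [exact: IHf | exact: IHg | | rewrite rincl_src rincl_tgt].
Qed.

Definition fincl (a : freecat (subext A)) : freecat X :=
  pcls _ (rincl_wf (prep_wf a)).

Lemma fincl_par a b : parallel a b -> parallel (fincl a) (fincl b).
Proof.
move=> p i hi; have := p i hi; rewrite /sb /tb /= /psb /ptb -ltnS hi.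
rewrite /fincl !psrc_cls !ptgt_cls !rincl_src !rincl_tgt.
by case=> /pidn_inj -> /pidn_inj ->.
Qed.

Lemma fincl_cls f wf : fincl (@pcls _ _ _ _ f wf) = pcls _ (rincl_wf wf).
Proof.
have wC i g h (w : rwf (Comp i g h)) : rwf (Comp i (rincl g) (rincl h)).
  exact: (@rincl_wf (Comp i g h)).
apply: qcls_eq; have := prepP (fun _ _ => False) wf.
move: (prep _) => g; elim=> {f wf g} //=.
- by move=> f wf; apply/req_refl/rincl_wf.
- by move=> f g _; apply: req_sym.
- by move=> f g h _ + _; apply: req_trans.
- by move=> i f f' g g' _ h _ h' w; apply: req_comp => //; apply: wC.
- by move=> i f g h w w'; apply: req_assoc; exact: wC.
- move=> i f wf hi; have := req_1l (fun _ _ => False) (rincl_wf wf) hi.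
  by rewrite /rsb hi rincl_src.
- move=> i f wf hi; have := req_1r (fun _ _ => False) (rincl_wf wf) hi.
  by rewrite /rtb hi rincl_tgt.
- move=> i j f g h k ij w1 w2 w3; apply: req_exch => //; exact: wC.
- by move=> i u v; apply: req_idt.
Qed.

End Subext.

Definition topgens n : pol n -> Type :=
  match n with
  | 0 => fun P => P
  | k.+1 => fun P => gens (topext P)
  end.

Definition restrict n : forall P : pol n, (topgens P -> Prop) -> pol n :=
  match n with
  | 0 => fun P A => {x : P | A x}
  | k.+1 => fun P A => @addext k (low P) (subext A)
  end.

Definition incl n : forall (P : pol n) (A : topgens P -> Prop),
    pstars (restrict A) -> pstars P :=
  match n with
  | 0 => fun P A => sval
  | k.+1 => fun P A => @fincl _ _ _ A
  end.

Lemma incl_par n (P : pol n) (A : topgens P -> Prop) u v :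
  parallel u v -> parallel (@incl n P A u) (@incl n P A v).
Proof. by case: n P A u v => [|n] P A u v; [move=> _ i | apply: fincl_par]. Qed.

Definition inclext n (P : pol n) (A : topgens P -> Prop)
    (X : cellext (pstars (restrict A))) : cellext (pstars P) :=
  @CellExt n _ X (fun x => incl (gsrc x)) (fun x => incl (gtgt x))
    (fun x => incl_par (gpar x)).

Section Modulo.
Variables (m : nat) (B : ncat m) (R E : cellext B).

(* The elements of [_E R_E]. *)
Record triple := Triple {
  tl : freegpd E;
  tm : freecat R;
  tr : freegpd E;
  tm_step : fsize tm = 1;
  tlm : tgt tl = src tm;
  tmr : tgt tm = src tr
}.

Lemma triple_par (t : triple) : parallel (src (tl t)) (tgt (tr t)).
Proof.
move=> i hi; have [] := parallel_bd (tl t) hi; rewrite tlm => -> ->.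
have [] := parallel_bd (tm t) hi; rewrite tmr => -> ->.
exact: parallel_bd.
Qed.

Definition ere : cellext B := CellExt triple_par.

Lemma fsize_gen (x : R) : fsize (fgen x) = 1.
Proof. exact: psizeE. Qed.
Lemma rule_src (x : R) : tgt (idn (freegpd E) (gsrc x)) = src (fgen x).
Proof. by rewrite tgt_idn; symmetry; apply: psrc_cls. Qed.
Lemma rule_tgt (x : R) : tgt (fgen x) = src (idn (freegpd E) (gtgt x)).
Proof. by rewrite src_idn; apply: ptgt_cls. Qed.

(* A rule [x] of [R] is identified with [(1, x, 1)]. *)
Definition rule (x : R) : ere := Triple (fsize_gen x) (rule_src x) (rule_tgt x).

Variable S : ere -> Prop.

Definition Sext : cellext B := subext S.

(* [(C[e], C[f], C[e'])] for [x = (e, f, e')]. *)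
Definition whisk3 (c : whisker B) (x : triple) :
    freegpd E * freecat R * freegpd E :=
  (whisk c (tl x), whisk c (tm x), whisk c (tr x)).

(* A whiskered generator [C[x]] is identified with the triple [whisk3 c x]. *)
Inductive triple_ax : raw Sext -> raw Sext -> Prop :=
  TripleAx (c c' : whisker B) (x x' : Sext) :
    whisk_ok c (gsrc x) -> whisk_ok c' (gsrc x') ->
    whisk3 c (sval x) = whisk3 c' (sval x') ->
    triple_ax (rwhisk c (Gen x)) (rwhisk c' (Gen x')).

Definition Sstar : overcat B := pres triple_ax.

Definition Sgen (x : Sext) : Sstar := pgen _ x.
Definition Ssize (f : Sstar) : nat := psize f.

(* [s] is a cell of size 1 and [t] is the corresponding triple. *)
Definition step_triple (s : Sstar) (t : freegpd E * freecat R * freegpd E) :=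
  exists (c : whisker B) (x : Sext),
    [/\ whisk_ok c (gsrc x), s = whisk c (Sgen x) & t = whisk3 c (sval x)].

(* [f' = e f], where [e] is precomposed to the first step of [f]; for a
   trivial [f] this makes sense only when [e] is an identity. *)
Definition precomp (e : freegpd E) (f f' : Sstar) : Prop :=
  (e = idn _ (src f) /\ f' = f) \/
  exists (s s' h : Sstar) (a : freegpd E) (r : freecat R) (b : freegpd E),
    [/\ step_triple s (a, r, b), step_triple s' (e *[m] a, r, b),
        tgt s = src h, f = s *[m] h & f' = s' *[m] h].

Lemma src_Sgen (x : Sext) : src (Sgen x) = gsrc x.
Proof. exact: psrc_cls. Qed.
Lemma tgt_Sgen (x : Sext) : tgt (Sgen x) = gtgt x.
Proof. exact: ptgt_cls. Qed.

Lemma step_triple_bd s t : step_triple s t ->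
  src s = src t.1.1 /\ tgt s = tgt t.2.
Proof.
move=> [c [x [ok -> ->]]].
have p : parallel (src (tr (sval x))) (gsrc x).
  move=> i hi; have [-> ->] := parallel_bd (tr (sval x)) hi.
  by have [-> ->] := gpar x hi.
have ok' : whisk_ok c (src (tr (sval x))).
  by apply: plug_ok_par ok => i hi; have [-> ->] := p i hi.
have okl : whisk_ok c (src (tl (sval x))) by [].
have E1 : src (whisk c (Sgen x)) = src (whisk c (tl (sval x))).
  by rewrite /whisk !src_plug ?src_Sgen.
have E2 : tgt (whisk c (Sgen x)) = tgt (whisk c (tr (sval x))).
  by rewrite /whisk !tgt_plug ?src_Sgen // tgt_Sgen.
by split.
Qed.

Lemma precomp_bd e f f' : tgt e = src f -> precomp e f f' ->
  src f' = src e /\ tgt f' = tgt f.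
Proof.
move=> h [[ee ->]|[s [s' [k [a [r [b]]]]]]].
  by split=> //; rewrite {1}ee src_idn.
case=> /step_triple_bd[s1 s2] /step_triple_bd[s3 s4] sk ef ->.
have ea : tgt e = src a by rewrite h ef src_comp.
have sk' : tgt s' = src k by rewrite s4 -s2.
by rewrite src_comp // tgt_comp // ef tgt_comp // s3 src_comp.
Qed.

End Modulo.

(* An n-polygraph modulo (R, E, S) with [n = m.+1].  [E] is the polygraph
   obtained from [R_(<= m)] by restricting its m-dimensional generators to the
   subset [pm_Em] and adding the cellular extension [pm_En]. *)
Record polmod (m : nat) := PolMod {
  pm_R : pol m.+1;
  pm_Em : topgens (low pm_R) -> Prop;
  pm_En : cellext (pstars (restrict pm_Em));
  pm_S : ere (topext pm_R) (inclext pm_En) -> Prop;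
  pm_RS : forall x : topext pm_R, pm_S (rule (inclext pm_En) x)
}.

Section PolModDefs.
Variables (m : nat) (P : polmod m).

Definition base : ncat m := pstars (low (pm_R P)).

Definition Etop : overcat base := freegpd (inclext (pm_En P)).
Definition Esize (e : Etop) : nat := gsize e.

Definition Sst : overcat base := Sstar (@pm_S m P).
Definition Sstsize (f : Sst) : nat := Ssize f.

Definition pm_terminating : Prop :=
  terminating (addext (ere (topext (pm_R P)) (inclext (pm_En P)))).

End PolModDefs.

Section Squares.
Variables (n : nat) (B : ncat n) (V H : overcat B).

Record square := Square {
  top : H;
  bot : H;
  lft : V;
  rgt : V;
  sq_tl : src top = src lft;
  sq_tr : tgt top = src rgt;
  sq_bl : src bot = tgt lft;
  sq_br : tgt bot = tgt rgt
}.

Record sqext := SqExt { sqs :> Type; bdy : sqs -> square }.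

Definition sqsum (G G' : sqext) : sqext :=
  @SqExt (sqs G + sqs G')%type
    (fun a => match a with inl x => bdy x | inr y => bdy y end).

(* In [PeiffL i f e] the horizontal cell is on the left of [*[i]], in
   [PeiffR i f e] it is on the right. *)
Inductive peiff_idx : Type :=
| PeiffL (i : nat) (f : H) (e : V) of i < n & tb i (src f) = sb i (src e)
| PeiffR (i : nat) (f : H) (e : V) of i < n & tb i (src e) = sb i (src f).

Lemma peiffL_bd i (f : H) (e : V) : i < n -> tb i (src f) = sb i (src e) ->
  [/\ src (f *[i] idn H (src e)) = src (idn V (src f) *[i] e),
      tgt (f *[i] idn H (src e)) = src (idn V (tgt f) *[i] e),
      src (f *[i] idn H (tgt e)) = tgt (idn V (src f) *[i] e) &
      tgt (f *[i] idn H (tgt e)) = tgt (idn V (tgt f) *[i] e)].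
Proof.
move=> hi h; have [_ pf] := parallel_bd f hi; have [pe _] := parallel_bd e hi.
have c1 : composable i f (idn H (src e)) by apply: composable_low; rewrite ?src_idn.
have c2 : composable i f (idn H (tgt e)) by apply: composable_low; rewrite ?src_idn -?pe.
have c3 : composable i (idn V (src f)) e by apply: composable_low; rewrite ?src_idn.
have c4 : composable i (idn V (tgt f)) e by apply: composable_low; rewrite ?src_idn -?pf.
by rewrite !src_star // !tgt_star // !src_idn !tgt_idn.
Qed.

Lemma peiffR_bd i (f : H) (e : V) : i < n -> tb i (src e) = sb i (src f) ->
  [/\ src (idn H (src e) *[i] f) = src (e *[i] idn V (src f)),
      tgt (idn H (src e) *[i] f) = src (e *[i] idn V (tgt f)),
      src (idn H (tgt e) *[i] f) = tgt (e *[i] idn V (src f)) &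
      tgt (idn H (tgt e) *[i] f) = tgt (e *[i] idn V (tgt f))].
Proof.
move=> hi h; have [pf _] := parallel_bd f hi; have [_ pe] := parallel_bd e hi.
have c1 : composable i (idn H (src e)) f by apply: composable_low; rewrite ?src_idn.
have c2 : composable i (idn H (tgt e)) f by apply: composable_low; rewrite ?src_idn -?pe.
have c3 : composable i e (idn V (src f)) by apply: composable_low; rewrite ?src_idn.
have c4 : composable i e (idn V (tgt f)) by apply: composable_low; rewrite ?src_idn -?pf.
by rewrite !src_star // !tgt_star // !src_idn !tgt_idn.
Qed.

Definition peiff_bdy (a : peiff_idx) : square :=
  match a with
  | PeiffL i f e hi h =>
      let: And4 p1 p2 p3 p4 := peiffL_bd hi h in
      @Square (f *[i] idn H (src e)) (f *[i] idn H (tgt e))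
              (idn V (src f) *[i] e) (idn V (tgt f) *[i] e) p1 p2 p3 p4
  | PeiffR i f e hi h =>
      let: And4 p1 p2 p3 p4 := peiffR_bd hi h in
      @Square (idn H (src e) *[i] f) (idn H (tgt e) *[i] f)
              (e *[i] idn V (src f)) (e *[i] idn V (tgt f)) p1 p2 p3 p4
  end.

Definition peiff : sqext := SqExt peiff_bdy.

End Squares.

Arguments top {n B V H}.
Arguments bot {n B V H}.
Arguments lft {n B V H}.
Arguments rgt {n B V H}.

(* Terms for the formal pastings of the squares of [G], whiskered by contexts
   of [B]: [SV] pastes along a common vertical edge, [SH] along a common
   horizontal edge.  They are taken modulo the laws of double categories with invertible vertical
   cells. *)

Section FreeDouble.
Variables (n : nat) (B : ncat n) (V H : overcat B) (G : sqext V H).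
Hypothesis Vinv : forall e : V, invertible e.

Inductive rsq : Type :=
| SGen of whisker B & G
| SIdH of H
| SIdV of V
| SV of rsq & rsq
| SH of rsq & rsq
| SInv of rsq.

Fixpoint rtop (p : rsq) : H :=
  match p with
  | SGen c a => whisk c (top (bdy a))
  | SIdH f => f
  | SIdV e => idn H (src e)
  | SV p q => rtop p *[n] rtop q
  | SH p q => rtop p
  | SInv p => rbot p
  end
with rbot (p : rsq) : H :=
  match p with
  | SGen c a => whisk c (bot (bdy a))
  | SIdH f => f
  | SIdV e => idn H (tgt e)
  | SV p q => rbot p *[n] rbot q
  | SH p q => rbot q
  | SInv p => rtop p
  end.

Fixpoint rlft (p : rsq) : V :=
  match p with
  | SGen c a => whisk c (lft (bdy a))
  | SIdH f => idn V (src f)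
  | SIdV e => e
  | SV p q => rlft p
  | SH p q => rlft p *[n] rlft q
  | SInv p => cinv (rlft p)
  end.

Fixpoint rrgt (p : rsq) : V :=
  match p with
  | SGen c a => whisk c (rgt (bdy a))
  | SIdH f => idn V (tgt f)
  | SIdV e => e
  | SV p q => rrgt q
  | SH p q => rrgt p *[n] rrgt q
  | SInv p => cinv (rrgt p)
  end.

Fixpoint sqwf (p : rsq) : Prop :=
  match p with
  | SGen c a => whisk_ok c (src (top (bdy a)))
  | SIdH _ | SIdV _ => True
  | SV p q => [/\ sqwf p, sqwf q & rrgt p = rlft q]
  | SH p q => [/\ sqwf p, sqwf q & rbot p = rtop q]
  | SInv p => sqwf p
  end.

Inductive sqeq : rsq -> rsq -> Prop :=
| sqeq_refl p : sqwf p -> sqeq p p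
| sqeq_sym p q : sqeq p q -> sqeq q p
| sqeq_trans p q r : sqeq p q -> sqeq q r -> sqeq p r
| sqeq_V p p' q q' : sqeq p p' -> sqeq q q' -> sqwf (SV p q) ->
    sqeq (SV p q) (SV p' q')
| sqeq_H p p' q q' : sqeq p p' -> sqeq q q' -> sqwf (SH p q) ->
    sqeq (SH p q) (SH p' q')
| sqeq_I p p' : sqeq p p' -> sqeq (SInv p) (SInv p')
| sqeq_VA p q r : sqwf (SV p q) -> sqwf (SV q r) ->
    sqeq (SV p (SV q r)) (SV (SV p q) r)
| sqeq_V1l p : sqwf p -> sqeq (SV (SIdV (rlft p)) p) p
| sqeq_V1r p : sqwf p -> sqeq (SV p (SIdV (rrgt p))) p
| sqeq_HA p q r : sqwf (SH p q) -> sqwf (SH q r) ->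
    sqeq (SH p (SH q r)) (SH (SH p q) r)
| sqeq_H1l p : sqwf p -> sqeq (SH (SIdH (rtop p)) p) p
| sqeq_H1r p : sqwf p -> sqeq (SH p (SIdH (rbot p))) p
| sqeq_HVl p : sqwf p -> sqeq (SH p (SInv p)) (SIdH (rtop p))
| sqeq_HVr p : sqwf p -> sqeq (SH (SInv p) p) (SIdH (rbot p))
| sqeq_exch p q p' q' : sqwf (SV p q) -> sqwf (SV p' q') ->
    sqwf (SH p p') -> sqwf (SH q q') ->
    sqeq (SH (SV p q) (SV p' q')) (SV (SH p p') (SH q q'))
| sqeq_idH f g : tgt f = src g ->
    sqeq (SIdH (f *[n] g)) (SV (SIdH f) (SIdH g))
| sqeq_idV e d : tgt e = src d ->
    sqeq (SIdV (e *[n] d)) (SH (SIdV e) (SIdV d))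
| sqeq_id u : sqeq (SIdH (idn H u)) (SIdV (idn V u)).

Lemma sqwf_bd p : sqwf p ->
  [/\ src (rtop p) = src (rlft p), tgt (rtop p) = src (rrgt p),
      src (rbot p) = tgt (rlft p) & tgt (rbot p) = tgt (rrgt p)].
Proof.
elim: p => [c a|f|e|p IHp q IHq|p IHp q IHq|p IHp] /=.
- case: (bdy a) => t b l r /= e1 e2 e3 e4 ok.
  have pl := parallel_bd l; have pt := parallel_bd t.
  have okl : whisk_ok c (src l) by rewrite -e1.
  have okb : whisk_ok c (src b) by rewrite e3; apply: plug_ok_par okl.
  have okr : whisk_ok c (src r) by rewrite -e2; apply: plug_ok_par ok.
  by rewrite /whisk !src_plug // !tgt_plug // e1 e2 e3 e4.
- by rewrite !src_idn !tgt_idn.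
- by rewrite !src_idn !tgt_idn.
- case=> /IHp[p1 p2 p3 p4] /IHq[q1 q2 q3 q4] h.
  have ht : tgt (rtop p) = src (rtop q) by rewrite p2 h.
  have hb : tgt (rbot p) = src (rbot q) by rewrite p4 h.
  by rewrite !src_comp // !tgt_comp.
- case=> /IHp[p1 p2 p3 p4] /IHq[q1 q2 q3 q4] h.
  have hl : tgt (rlft p) = src (rlft q) by rewrite -p3 h.
  have hr : tgt (rrgt p) = src (rrgt q) by rewrite -p4 h.
  by rewrite !src_comp // !tgt_comp.
- move=> /IHp[p1 p2 p3 p4].
  have [i1 i2 _ _] := cinvP (Vinv (rlft p)).
  have [j1 j2 _ _] := cinvP (Vinv (rrgt p)).
  by rewrite -i1 i2 -j1 j2.
Qed.

Lemma sqeq_ok p q : sqeq p q ->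
  [/\ sqwf p, sqwf q &
  [/\ rtop p = rtop q, rbot p = rbot q, rlft p = rlft q & rrgt p = rrgt q]].
Proof.
elim=> {p q} //.
- by move=> p q _ [? ? [-> -> -> ->]].
- by move=> p q r _ [? ? [-> -> -> ->]] _ [? ? [-> -> -> ->]].
- move=> p p' q q' _ [? ? [t b l r]] _ [? ? [t' b' l' r']] w.
  by case: (w) => _ _ e; split=> //=; rewrite -?t -?b -?l -?r -?t' -?b' -?l' -?r'.
- move=> p p' q q' _ [? ? [t b l r]] _ [? ? [t' b' l' r']] w.
  by case: (w) => _ _ e; split=> //=; rewrite -?t -?b -?l -?r -?t' -?b' -?l' -?r'.
- by move=> p p' _ [? ? [t b l r]]; split=> //=; rewrite -?t -?b -?l -?r.
- move=> p q r [wp wq e1] [_ wr e2]; split=> //=.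
  have [_ p2 _ p4] := sqwf_bd wp; have [q1 q2 q3 q4] := sqwf_bd wq.
  have [r1 _ r3 _] := sqwf_bd wr.
  by rewrite !compA // ?p2 ?p4 ?q2 ?q4 ?q1 ?q3 ?r1 ?r3 ?e1 ?e2.
- move=> p wp; have [p1 p2 p3 p4] := sqwf_bd wp; split=> //=.
  by rewrite -p1 -p3 !comp1f.
- move=> p wp; have [p1 p2 p3 p4] := sqwf_bd wp; split=> //=.
  by rewrite -p2 -p4 !compf1.
- move=> p q r [wp wq e1] [_ wr e2]; split=> //=.
  have [p1 p2 p3 p4] := sqwf_bd wp; have [q1 q2 q3 q4] := sqwf_bd wq.
  have [r1 r2 r3 r4] := sqwf_bd wr.
  by rewrite !compA // -?p3 -?p4 -?q1 -?q2 -?q3 -?q4 -?r1 -?r2 ?e1 ?e2.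
- move=> p wp; have [p1 p2 p3 p4] := sqwf_bd wp; split=> //=.
  by rewrite p1 p2 !comp1f.
- move=> p wp; have [p1 p2 p3 p4] := sqwf_bd wp; split=> //=.
  by rewrite p3 p4 !compf1.
- move=> p wp; have [p1 p2 p3 p4] := sqwf_bd wp; split=> //=.
  have [_ _ -> _] := cinvP (Vinv (rlft p)).
  have [_ _ -> _] := cinvP (Vinv (rrgt p)).
  by rewrite p1 p2.
- move=> p wp; have [p1 p2 p3 p4] := sqwf_bd wp; split=> //=.
  have [_ _ _ ->] := cinvP (Vinv (rlft p)).
  have [_ _ _ ->] := cinvP (Vinv (rrgt p)).
  by rewrite p3 p4.
- move=> p q p' q' [wp wq e1] [wp' wq' e2] [_ _ e3] [_ _ e4].
  by split=> //=; split=> //=; rewrite ?e1 ?e2 ?e3 ?e4.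
- move=> f g h; split=> //=; first by rewrite h.
  by rewrite src_comp // tgt_comp.
- move=> e d h; split=> //=; first by rewrite h.
  by rewrite src_comp // tgt_comp.
- by move=> u; split=> //=; rewrite !src_idn !tgt_idn.
Qed.

Definition sqcell : Type := quot sqeq_refl sqeq_sym sqeq_trans.
Definition sqcls p (wp : sqwf p) : sqcell :=
  qcls sqeq_refl sqeq_sym sqeq_trans wp.

Definition sqtop (A : sqcell) : H := rtop (qrep A).
Definition sqbot (A : sqcell) : H := rbot (qrep A).
Definition sqlft (A : sqcell) : V := rlft (qrep A).
Definition sqrgt (A : sqcell) : V := rrgt (qrep A).

Lemma sqcls_bd p wp : [/\ sqtop (@sqcls p wp) = rtop p,
  sqbot (@sqcls p wp) = rbot p, sqlft (@sqcls p wp) = rlft p &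
  sqrgt (@sqcls p wp) = rrgt p].
Proof. by case: (sqeq_ok (qrepP sqeq_refl sqeq_sym sqeq_trans wp)). Qed.

End FreeDouble.

Section Confluence.
Variables (m : nat) (P : polmod m) (Gamma : sqext (Etop P) (Sst P)).

Lemma Etop_inv (e : Etop P) : invertible e.
Proof. exact: freegpd_inv. Qed.

(* [act_f = e_1 f] and [act_g = e_2^- g], for [f] and [g] the top and bottom
   of [act_A]. *)
Record action_idx := ActionIdx {
  act_A : Gamma;
  act_e1 : Etop P;
  act_e2 : Etop P;
  act_f : Sst P;
  act_g : Sst P;
  act_h1 : tgt act_e1 = src (lft (bdy act_A));
  act_h2 : src act_e2 = tgt (lft (bdy act_A));
  act_pf : precomp act_e1 (top (bdy act_A)) act_f;
  act_pg : precomp (cinv act_e2) (bot (bdy act_A)) act_g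
}.

Section ActionBdy.
Variable a : action_idx.
Let A := bdy (act_A a).

Lemma action_bd :
  [/\ src (act_f a) = src (act_e1 a *[m] lft A *[m] act_e2 a),
      tgt (act_f a) = src (rgt A),
      src (act_g a) = tgt (act_e1 a *[m] lft A *[m] act_e2 a) &
      tgt (act_g a) = tgt (rgt A)].
Proof.
have h1 := act_h1 a; have h2 := act_h2 a; rewrite -/A in h1 h2.
have [i1 i2 _ _] := cinvP (Etop_inv (act_e2 a)).
have hf : tgt (act_e1 a) = src (top A) by rewrite sq_tl.
have hg : tgt (cinv (act_e2 a)) = src (bot A) by rewrite i2 sq_bl.
have [f1 f2] := precomp_bd hf (act_pf a).
have [g1 g2] := precomp_bd hg (act_pg a).
have h3 : tgt (act_e1 a *[m] lft A) = src (act_e2 a) by rewrite tgt_comp.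
by rewrite f1 f2 g1 g2 sq_tr sq_br !src_comp // tgt_comp // i1.
Qed.

Definition action_bdy : square (Etop P) (Sst P) :=
  let: And4 p1 p2 p3 p4 := action_bd in
  @Square _ _ (Etop P) (Sst P) (act_f a) (act_g a)
    (act_e1 a *[m] lft A *[m] act_e2 a) (rgt A) p1 p2 p3 p4.

End ActionBdy.

Definition action : sqext (Etop P) (Sst P) := SqExt action_bdy.

Definition Gcell : Type := sqcell (sqsum action (peiff (Etop P) (Sst P))).

Definition branching (f : Sst P) (e : Etop P) (g : Sst P) : Prop :=
  [/\ f <> idn (Sst P) (src f), src f = src e & src g = tgt e].

Definition local_branching (f : Sst P) (e : Etop P) (g : Sst P) : Prop :=
  [/\ branching f e g, Sstsize f = 1 & Sstsize g + Esize e = 1].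

Definition branching_confluent (f : Sst P) (e : Etop P) (g : Sst P) : Prop :=
  exists (f' g' : Sst P) (e' : Etop P) (A : Gcell),
    [/\ tgt f = src f', tgt g = src g' &
    [/\ sqtop A = f *[m] f', sqbot A = g *[m] g', sqlft A = e & sqrgt A = e']].

Definition locally_confluent : Prop :=
  forall f e g, local_branching f e g -> branching_confluent f e g.

Definition confluent : Prop :=
  forall f e g, branching f e g -> branching_confluent f e g.

End Confluence.

(* Main.v *)
(* Call a cell of [base] normal when no step of [S] starts from it.  Termination
   gives normal forms, and the statement proved by well-founded induction is
   stronger than confluence: an edge [e : u -> u'] of [Etop] and any two
   reductions of [u] and [u'] to normal forms bound a square, with no extension
   of its horizontal sides.  The induction follows the steps of [_E R_E], whose
   set of targets from [u] only depends on the [E]-class of [u]; one can thus cut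
   [e] into edges of size one without losing the induction hypothesis.  Along
   each of them local confluence gives a square, which is extended to normal
   forms by the induction hypothesis and completed by pasting. *)

From mathcomp Require Import all_boot.
From mathcomp Require Import boolp.
Require Import Defs.

Set Implicit Arguments.
Unset Strict Implicit.
Unset Printing Implicit Defensive.

(** * Composability, interchange and inverses over a fixed base *)

Section OvercatExtra.
Variables (n : nat) (B : ncat n) (O : overcat B).
Implicit Types (u v : B) (f g h : O).

Lemma idn_comp u : idn O u *[n] idn O u = idn O u.
Proof. by have := comp1f (idn O u); rewrite src_idn. Qed.

Lemma composable_topE f g : composable n f g -> tgt f = src g.
Proof. by case=> _; rewrite -idn_tgt -idn_src => /idn_inj. Qed.

(** Below the top dimension, composability depends only on iterated boundaries, so it transfers to
    cells with parallel sources, even over another overcategory of [B]. *)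
Lemma composable_bd (O' : overcat B) i f g (f' g' : O') : i < n ->
  parallel (src f) (src f') -> parallel (src g) (src g') ->
  composable i f g -> composable i f' g'.
Proof.
move=> hi pf pg c; apply: composable_low => //.
by rewrite -(pf i hi).2 -(pg i hi).1; case: (composable_src hi c).
Qed.

Lemma interchange i f g h k : i < n -> tgt f = src g -> tgt h = src k ->
  composable i f h ->
  (f *[n] g) *[i] (h *[n] k) = (f *[i] h) *[n] (g *[i] k).
Proof. by move=> hi fg hk c; rewrite star_exch //; apply: composable_top. Qed.

Lemma inverse_unique f g h : is_inverse f g -> is_inverse f h -> g = h.
Proof.
move=> [g1 g2 g3 g4] [h1 h2 h3 h4].
have e : src g = src h by rewrite -g1.
by rewrite -(compf1 g) g2 -h3 compA ?g4 // h1 comp1f.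
Qed.

Lemma is_inverse_comp f g f' g' : tgt f = src g ->
  is_inverse f f' -> is_inverse g g' -> is_inverse (f *[n] g) (g' *[n] f').
Proof.
move=> efg [f1 f2 f3 f4] [g1 g2 g3 g4].
have h1 : tgt g' = src f' by rewrite g2 -efg.
have h2 : tgt f' = src (f *[n] g) by rewrite src_comp.
split; rewrite ?src_comp ?tgt_comp //.
- by rewrite compA ?tgt_comp // -(compA efg g1) g3 -efg compf1 f3.
- by rewrite -(compA h1 h2) (compA f2 efg) f4 efg comp1f g4.
Qed.

Lemma is_inverse_star i f g f' g' : i < n -> composable i f g ->
  is_inverse f f' -> is_inverse g g' -> is_inverse (f *[i] g) (f' *[i] g').
Proof.
move=> hi c [f1 f2 f3 f4] [g1 g2 g3 g4].
have c' : composable i f' g'.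
  by apply: composable_low => //; rewrite -f1 -g1; case: (composable_tgt hi c).
split.
- by rewrite tgt_star // src_star // f1 g1.
- by rewrite tgt_star // src_star // f2 g2.
- rewrite -interchange // f3 g3 src_star // idn_star //.
  exact: composable_src.
- rewrite -interchange // f4 g4 tgt_star // idn_star //.
  exact: composable_tgt.
Qed.

End OvercatExtra.

(** * Size in a presented category and decomposition into steps *)

Section PresSize.
Variables (n : nat) (C : ncat n) (X : cellext C) (ax : raw X -> raw X -> Prop).
Local Notation D := (pres ax).

Lemma pcls_comp i f g (wf : rwf f) (wg : rwf g) (w : rwf (Comp i f g)) :
  composable i (pcls ax wf : D) (pcls ax wg : D) /\
  pcls ax w = (pcls ax wf : D) *[i] pcls ax wg.
Proof.
have h : req ax (Comp i (prep (pcls ax wf)) (prep (pcls ax wg))) (Comp i f g).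
  by apply: req_sym; apply: req_comp w; apply: req_sym; apply: prepP.
have c : pcomposable i (pcls ax wf) (pcls ax wg).
  exact/pcomposableE/(req_rwfl h).
split=> //; apply: pcell_ext; apply: req_trans (prepP _ w) _; apply: req_sym.
exact: req_trans (pstarP c) h.
Qed.

Lemma psize_le f (wf : rwf f) : psize (pcls ax wf : D) <= ngen f.
Proof.
rewrite /psize; case: ex_minnP => k _; apply.
by apply/asboolP; exists f, wf.
Qed.

Lemma psize_rep (a : D) : exists f (wf : rwf f), pcls ax wf = a /\ ngen f = psize a.
Proof. by rewrite /psize; case: ex_minnP => k /asboolP. Qed.

(** Induction on a term for [a] with the fewest generators. [Q] is indexed by the generator count of
    the term, since sizes need not add up when [ax] changes this count, as the inverse laws do. *)
Lemma pres_size_ind (Q : nat -> D -> Prop) :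
  (forall x, Q 1 (pgen ax x)) -> (forall u, Q 0 (idn D u)) ->
  (forall i k l a b, composable i a b -> Q k a -> Q l b -> Q (k + l) (a *[i] b)) ->
  forall a, Q (psize a) a.
Proof.
move=> Qg Qi Qc a; have [f [wf [<- <-]]] := psize_rep a.
elim: f wf {a} => [x|u|i f IHf g IHg] wf.
- by have -> : pcls ax wf = pgen ax x by apply/qcls_eq/req_refl.
- by have -> : pcls ax wf = idn D u by apply/qcls_eq/req_refl.
- have [wf1 wg1 _ _] := wf; have [c ->] := pcls_comp wf1 wg1 wf.
  exact: Qc c (IHf wf1) (IHg wg1).
Qed.

Lemma psize_gen x : psize (pgen ax x) <= 1.
Proof. exact: psize_le. Qed.

Lemma psize_idn u : psize (idn D u) = 0.
Proof. by apply/eqP; rewrite -leqn0; apply: (@psize_le (Idt u)). Qed.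

Lemma psize_star_rep i (a b : D) : composable i a b ->
  exists f g (wf : rwf f) (wg : rwf g) (w : rwf (Comp i f g)),
    [/\ pcls ax wf = a, pcls ax wg = b, pcls ax w = a *[i] b,
        ngen f = psize a & ngen g = psize b].
Proof.
have [f [wf [ea sa]]] := psize_rep a; have [g [wg [eb sb]]] := psize_rep b.
move=> c; have w : rwf (Comp i f g).
  case: (c) => hi; rewrite /tb /sb /= /ptb /psb -ltnS hi => /pidn_inj.
  by rewrite -ea -eb ptgt_cls psrc_cls.
exists f, g, wf, wg, w; split=> //; have [_ ->] := pcls_comp wf wg w.
by rewrite ea eb.
Qed.

Lemma psize_star i (a b : D) : composable i a b ->
  psize (a *[i] b) <= psize a + psize b.
Proof.
move=> /psize_star_rep[f [g [wf [wg [w [_ _ <- <- <-]]]]]].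
exact: psize_le.
Qed.

Lemma psize_starE i (a b : D) : (forall f g, ax f g -> ngen f = ngen g) ->
  composable i a b -> psize (a *[i] b) = psize a + psize b.
Proof.
move=> hax /psize_star_rep[f [g [wf [wg [w [_ _ <- <- <-]]]]]].
exact: psizeE.
Qed.

(** A term without generators is a composite of identities, which collapses to a single identity. *)
Lemma psize0 (a : D) : psize a = 0 -> a = idn D (src a).
Proof.
move: a; refine (@pres_size_ind (fun k a => k = 0 -> a = idn D (src a)) _ _ _).
- by [].
- by move=> u _; rewrite src_idn.
- move=> i k l a b c Qa Qb /eqP; rewrite addn_eq0 => /andP[/eqP/Qa ea /eqP/Qb eb].
  case: (ltnP i n) => hi.
    by rewrite src_star // idn_star -?ea -?eb //; apply: composable_src.
  have ei : i = n by apply/eqP; rewrite eqn_leq hi; case: c; rewrite ltnS => ->.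
  subst i; have e := composable_topE c.
  have ea' : a = idn D (src b) by rewrite -e [in RHS]ea tgt_idn.
  by rewrite src_comp // ea' comp1f src_idn.
Qed.

Inductive step_path : D -> Prop :=
| step_path_idn u : step_path (idn D u)
| step_path_cons s a : psize s = 1 -> tgt s = src a -> step_path a ->
    step_path (s *[n] a).

(** A cell of size zero is an identity and gets absorbed; the upper bound given by [psize_star] is
    thus enough to lengthen a path. *)
Lemma step_path_cons_le s a : psize s <= 1 -> tgt s = src a -> step_path a ->
  step_path (s *[n] a).
Proof.
rewrite leq_eqVlt ltnS leqn0 => /orP[/eqP|/eqP/psize0 es] e pa.
  by move=> hs; apply: step_path_cons.
by move: e; rewrite es tgt_idn => ->; rewrite comp1f.
Qed.

Lemma step_path_idn_star i u b : i < n -> composable i (idn D u) b ->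
  step_path b -> step_path (idn D u *[i] b).
Proof.
move=> hi c pb; elim: pb c => [v|s a hs e pa IH] c.
  rewrite -idn_star; first exact: step_path_idn.
  by have := composable_src hi c; rewrite !src_idn.
have [c1 c2] : composable i (idn D u) s /\ composable i (idn D u) a.
  have ps : parallel (src (s *[n] a)) (src s) by rewrite src_comp.
  have pa' : parallel (src (s *[n] a)) (src a).
    by rewrite src_comp // -e; apply: parallel_bd.
  by split; apply: composable_bd c.
(* Doubling the identity lets the exchange law split off the first step [s]. *)
rewrite -(idn_comp _ u) interchange ?tgt_idn ?src_idn //.
apply: step_path_cons_le (IH c2).
  by apply: leq_trans (psize_star c1) _; rewrite psize_idn hs.
by rewrite tgt_star // src_star // tgt_idn src_idn e.
Qed.

(** For [i = n] the paths are concatenated. For [i < n] the exchange law performs the steps of [a]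
    beside the source of [b], then those of [b] beside the target of [a]. *)
Lemma step_path_star i a b : composable i a b ->
  step_path a -> step_path b -> step_path (a *[i] b).
Proof.
move=> c pa pb; case: (ltnP i n) => hi; last first.
  have ei : i = n by apply/eqP; rewrite eqn_leq hi; case: c; rewrite ltnS => ->.
  subst i; have := composable_topE c => {c hi}.
  elim: pa => [u|s a' hs e pa IH].
    by rewrite tgt_idn => ->; rewrite comp1f.
  rewrite tgt_comp // => e'; rewrite -compA //.
  by apply: step_path_cons (IH e') => //; rewrite src_comp.
elim: pa c => [u c|s a' hs e pa IH c]; first exact: step_path_idn_star.
have [c1 c2] : composable i s (idn D (src b)) /\ composable i a' b.
  have ps : parallel (src (s *[n] a')) (src s) by rewrite src_comp.
  have pa' : parallel (src (s *[n] a')) (src a').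
    by rewrite src_comp // -e; apply: parallel_bd.
  by split; apply: composable_bd c => //; rewrite src_idn.
rewrite -{1}(comp1f b) interchange ?tgt_idn //.
apply: step_path_cons_le (IH c2).
  by apply: leq_trans (psize_star c1) _; rewrite psize_idn hs.
by rewrite tgt_star // src_star // tgt_idn e.
Qed.

Lemma step_pathP (a : D) : step_path a.
Proof.
refine (@pres_size_ind (fun _ => step_path) _ _ _ a) => [x|u|i _ _ b c].
- rewrite -[pgen ax x](@compf1 _ _ D).
  apply: step_path_cons_le; first exact: psize_gen.
    by rewrite src_idn.
  exact: step_path_idn.
- exact: step_path_idn.
- exact: step_path_star.
Qed.

End PresSize.

(** * Size of inverses in the free category with invertible top cells *)

Section FreegpdSize.
Variables (n : nat) (C : ncat n) (X : cellext C).
Local Notation G := (freegpd X).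

Lemma dgen_inverse x b :
  is_inverse (pgen _ (dgen x b) : G) (pgen _ (dgen x (~~ b))).
Proof.
have c b' : req (@inv_ax n C X)
    (Comp n (Gen (dgen x b')) (Gen (dgen x (~~ b')))) (Idt (gsrc (dgen x b'))).
  apply: req_ax; last exact: InvAx.
  - by split=> //=; rewrite tb_top ?sb_top //; case: b'.
  - by [].
  - by rewrite /= ltnn.
  - by rewrite /= ltnn; case: b'.
have st b' : src (pgen _ (dgen x b') : G) = gsrc (dgen x b') by exact: psrc_cls.
have tg b' : tgt (pgen _ (dgen x b') : G) = gtgt (dgen x b') by exact: ptgt_cls.
have E b' : (pgen _ (dgen x b') : G) *[n] pgen _ (dgen x (~~ b')) =
    idn G (gsrc (dgen x b')).
  have w := req_rwfl (c b').
  have [_ <-] := @pcls_comp _ _ _ (@inv_ax n C X) n (Gen _) (Gen _) I I w.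
  exact/qcls_eq/c.
by split; rewrite ?st ?tg ?E //; case: b.
Qed.

(** Inverses are unique, so it suffices to bound one of them: inverting each generator of a shortest
    term, and reversing the order of top-dimensional composites, adds no generator. *)
Lemma gsize_cinv (e : G) : gsize (cinv e) <= gsize e.
Proof.
suff [g [ig sg]] : exists g : G, is_inverse e g /\ gsize g <= gsize e.
  by rewrite (inverse_unique (cinvP (freegpd_inv e)) ig).
rewrite /gsize; move: e; refine (@pres_size_ind _ _ _ _
  (fun k e => exists g : G, is_inverse e g /\ psize g <= k) _ _ _).
- move=> [x b]; exists (pgen _ (dgen x (~~ b))).
  by split; [exact: dgen_inverse | exact: psize_gen].
- move=> u; exists (idn G u); split; last by rewrite psize_idn.
  by split; rewrite ?src_idn ?tgt_idn // idn_comp.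
- move=> i k l a b c [a' [ia sa]] [b' [ib sb]].
  case: (ltnP i n) => hi.
    exists (a' *[i] b'); split; first exact: is_inverse_star.
    apply: leq_trans (leq_add sa sb); apply: psize_star.
    case: ia ib => [a1 _ _ _] [b1 _ _ _]; apply: composable_low => //.
    by rewrite -a1 -b1; case: (composable_tgt hi c).
  have ei : i = n by apply/eqP; rewrite eqn_leq hi; case: c; rewrite ltnS => ->.
  subst i; have e := composable_topE c.
  exists (b' *[n] a'); split; first exact: is_inverse_comp.
  rewrite addnC; apply: leq_trans (leq_add sb sa); apply: psize_star.
  by case: ia ib => [a1 _ _ _] [_ b2 _ _]; apply: composable_top; rewrite b2 -e.
Qed.

End FreegpdSize.

(** * The one-step relation of rewriting modulo *)

Section ModuloStep.
Variables (m : nat) (B : ncat m) (R E : cellext B).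

Definition ere_step (u v : B) : Prop :=
  exists t : triple R E, src (tl t) = u /\ tgt (tr t) = v.

(** The edge [e] is absorbed into the left component of the triple. This carries an induction
    hypothesis from one end of an edge to the other. *)
Lemma ere_step_precomp (e : freegpd E) v :
  ere_step (tgt e) v -> ere_step (src e) v.
Proof.
move=> [t [ht <-]].
have h : tgt (e *[m] tl t) = src (tm t) by rewrite tgt_comp // tlm.
by exists (Triple (tm_step t) h (tmr t)); split=> //; apply: src_comp; rewrite ht.
Qed.

Lemma parallel_triple (t : triple R E) :
  parallel (src (tl t)) (src (tm t)) /\ parallel (src (tl t)) (src (tr t)).
Proof.
have p : parallel (src (tl t)) (src (tm t)) by rewrite -tlm; apply: parallel_bd.
split=> // i hi; have [-> ->] := p i hi.
by rewrite -tmr; apply: parallel_bd.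
Qed.

Lemma fsize_star_idn i (f : freecat R) u : composable i f (idn (freecat R) u) ->
  fsize (f *[i] idn (freecat R) u) = fsize f.
Proof. by move=> c; rewrite /fsize psize_starE // psize_idn addn0. Qed.

Lemma fsize_idn_star i (f : freecat R) u : composable i (idn (freecat R) u) f ->
  fsize (idn (freecat R) u *[i] f) = fsize f.
Proof. by move=> c; rewrite /fsize psize_starE // psize_idn. Qed.

(** The three components of the triple are whiskered at once; the middle one keeps size one because
    an identity contains no generator. *)
Lemma ere_step_star_r i u v w : i < m -> composable i u w ->
  ere_step u v -> ere_step (u *[i] w) (v *[i] w).
Proof.
move=> hi [_ c] [t [hu hv]]; subst u v; have [p1 p2] := parallel_triple t.
have ci (O : overcat B) (f : O) : parallel (src (tl t)) (src f) ->
    composable i f (idn O w).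
  by move=> p; apply: composable_low; rewrite // src_idn -c (p i hi).2.
have cl := ci _ (tl t) (fun _ _ => conj erefl erefl).
have cm := ci _ (tm t) p1; have cr := ci _ (tr t) p2.
have h1 : fsize (tm t *[i] idn (freecat R) w) = 1.
  by rewrite fsize_star_idn // tm_step.
have h2 : tgt (tl t *[i] idn (freegpd E) w) = src (tm t *[i] idn (freecat R) w).
  by rewrite tgt_star // src_star // tgt_idn src_idn tlm.
have h3 : tgt (tm t *[i] idn (freecat R) w) = src (tr t *[i] idn (freegpd E) w).
  by rewrite tgt_star // src_star // tgt_idn src_idn tmr.
exists (Triple h1 h2 h3); split.
  by rewrite [LHS]src_star // src_idn.
by rewrite [LHS]tgt_star // tgt_idn.
Qed.

Lemma ere_step_star_l i u v w : i < m -> composable i w u ->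
  ere_step u v -> ere_step (w *[i] u) (w *[i] v).
Proof.
move=> hi [_ c] [t [hu hv]]; subst u v; have [p1 p2] := parallel_triple t.
have ci (O : overcat B) (f : O) : parallel (src (tl t)) (src f) ->
    composable i (idn O w) f.
  by move=> p; apply: composable_low; rewrite // src_idn c (p i hi).1.
have cl := ci _ (tl t) (fun _ _ => conj erefl erefl).
have cm := ci _ (tm t) p1; have cr := ci _ (tr t) p2.
have h1 : fsize (idn (freecat R) w *[i] tm t) = 1.
  by rewrite fsize_idn_star // tm_step.
have h2 : tgt (idn (freegpd E) w *[i] tl t) = src (idn (freecat R) w *[i] tm t).
  by rewrite tgt_star // src_star // tgt_idn src_idn tlm.
have h3 : tgt (idn (freecat R) w *[i] tm t) = src (idn (freegpd E) w *[i] tr t).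
  by rewrite tgt_star // src_star // tgt_idn src_idn tmr.
exists (Triple h1 h2 h3); split.
  by rewrite [LHS]src_star // src_idn.
by rewrite [LHS]tgt_star // tgt_idn.
Qed.

Lemma Sstar_step (S : ere R E -> Prop) (s : Sstar S) : Ssize s = 1 ->
  ere_step (src s) (tgt s).
Proof.
rewrite /Ssize => hs; suff : psize s <= psize s /\
    (psize s = 1 -> ere_step (src s) (tgt s)) by case=> _; apply.
(* The bound [psize s <= k] is carried along so that, when [k + l = 1], the factor with count zero
   is an identity by [psize0]; the other factor then provides the triple. *)
move: s {hs}; refine (@pres_size_ind _ _ _ _ (fun k s =>
  psize s <= k /\ (k = 1 -> ere_step (src s) (tgt s))) _ _ _).
- move=> x; split=> [|_]; first exact: psize_gen.
  by exists (sval x); rewrite (src_Sgen x) (tgt_Sgen x).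
- by move=> u; rewrite psize_idn.
- move=> i k l a b c [ak ka] [bl lb]; split.
    exact: leq_trans (psize_star c) (leq_add ak bl).
  case: (ltnP i m) => hi; last first.
    have ei : i = m by apply/eqP; rewrite eqn_leq hi; case: c; rewrite ltnS => ->.
    subst i; have e := composable_topE c.
    rewrite src_comp // tgt_comp //.
    case: k ak ka => [|[|//]] ak ka h.
      have ea : a = idn _ (src a) by apply: psize0; apply/eqP; rewrite -leqn0.
      by have := lb h; rewrite -e {1}ea tgt_idn.
    have l0 : l = 0 by case: h.
    have eb : b = idn _ (src b).
      by apply: psize0; apply/eqP; rewrite -leqn0 -l0.
    by have := ka erefl; rewrite e eb src_idn tgt_idn.
  rewrite src_star // tgt_star //.
  case: k ak ka => [|[|//]] ak ka h.
    have ea : a = idn _ (src a) by apply: psize0; apply/eqP; rewrite -leqn0.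
    have := composable_src hi c; rewrite [in tgt a]ea tgt_idn => c'.
    exact: ere_step_star_l (lb h).
  have l0 : l = 0 by case: h.
  have eb : b = idn _ (src b).
    by apply: psize0; apply/eqP; rewrite -leqn0 -l0.
  have := composable_src hi c; rewrite [in tgt b]eb tgt_idn => c'.
  exact: ere_step_star_r (ka _).
Qed.

End ModuloStep.

(** * Pasting of square cells, recorded by their boundaries *)

Section SquareCells.
Variables (n : nat) (B : ncat n) (V H : overcat B) (G : sqext V H).
Hypothesis Vinv : forall e : V, invertible e.

Definition fills (f g : H) (e e' : V) : Prop :=
  exists A : sqcell G,
    [/\ sqtop A = f, sqbot A = g, sqlft A = e & sqrgt A = e'].

(** Only the existence of a cell with a given boundary matters here, so pastings can be made on
    representing terms. *)
Lemma fillsP f g e e' : fills f g e e' <-> exists p : rsq G,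
  [/\ sqwf p, rtop p = f, rbot p = g, rlft p = e & rrgt p = e'].
Proof.
split=> [[A [<- <- <- <-]]|[p [wp <- <- <- <-]]].
  by exists (qrep A); split=> //; apply: qrep_ok.
by exists (sqcls wp); apply: sqcls_bd.
Qed.

Lemma fills_bd f g e e' : fills f g e e' ->
  [/\ src f = src e, tgt f = src e', src g = tgt e & tgt g = tgt e'].
Proof. by case/fillsP=> p [/(sqwf_bd Vinv)[? ? ? ?] <- <- <- <-]. Qed.

Lemma fills_idH f : fills f f (idn V (src f)) (idn V (tgt f)).
Proof. by apply/fillsP; exists (SIdH _ f). Qed.

Lemma fills_idV e : fills (idn H (src e)) (idn H (tgt e)) e e.
Proof. by apply/fillsP; exists (SIdV _ e). Qed.

Lemma fills_V f g e e' f' g' e'' : fills f g e e' -> fills f' g' e' e'' ->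
  fills (f *[n] f') (g *[n] g') e e''.
Proof.
move=> /fillsP[p [wp <- <- <- hp]] /fillsP[q [wq <- <- hq <-]].
by apply/fillsP; exists (SV p q); split=> //=; rewrite hp hq.
Qed.

Lemma fills_H f g h e e' d d' : fills f g e e' -> fills g h d d' ->
  fills f h (e *[n] d) (e' *[n] d').
Proof.
move=> /fillsP[p [wp <- hp <- <-]] /fillsP[q [wq hq <- <- <-]].
by apply/fillsP; exists (SH p q); split=> //=; rewrite hp hq.
Qed.

Lemma fills_inv f g e e' : fills f g e e' -> fills g f (cinv e) (cinv e').
Proof. by move=> /fillsP[p [wp <- <- <- <-]]; apply/fillsP; exists (SInv p). Qed.

End SquareCells.

(** * Noetherian induction on squares between normal forms *)

Section Newman.
Variables (m : nat) (P : polmod m) (Gamma : sqext (Etop P) (Sst P)).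
Implicit Types (u v : base P) (f g h s t : Sst P) (e d : Etop P).

Local Notation estep :=
  (@ere_step m (base P) (topext (pm_R P)) (inclext (pm_En P))).
Local Notation squares := (sqsum (action Gamma) (peiff (Etop P) (Sst P))).
Local Notation square_cell := (fills squares).

Let Vinv := @Etop_inv m P.

(** A non-accessible cell has a non-accessible successor. Iterating a choice of successors gives an
    infinite sequence of composable generators, which are rewriting steps. *)
Lemma ere_step_wf : pm_terminating P -> well_founded (fun v u => estep u v).
Proof.
move=> term u0; apply: contrapT => bad0.
pose bad := {u | ~ Acc (fun v u => estep u v) u}.
have next (b : bad) : {t : triple (topext (pm_R P)) (inclext (pm_En P)) |
    src (tl t) = sval b /\ ~ Acc (fun v u => estep u v) (tgt (tr t))}.
  apply: cid; apply: contrapT => none; case: b none => u nu /= none.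
  apply: nu; constructor=> v [t [ht <-]]; apply: contrapT => nv.
  by apply: none; exists t.
pose succ (b : bad) : bad := exist _ (tgt (tr (sval (next b)))) (svalP (next b)).2.
pose b k : bad := iter k succ (exist _ u0 bad0).
pose X := ere (topext (pm_R P)) (inclext (pm_En P)).
have src_fgen (x : X) : src (fgen x) = gsrc x by apply: psrc_cls.
have tgt_fgen (x : X) : tgt (fgen x) = gtgt x by apply: ptgt_cls.
apply: term; exists (fun k => @fgen _ _ X (sval (next (b k)))) => k.
split; first exact: fsize_gen.
rewrite tgt_fgen src_fgen.
exact: esym (svalP (next (b k.+1))).1.
Qed.

Lemma Sst_cases f : f = idn (Sst P) (src f) \/
  exists s a, [/\ Sstsize s = 1, tgt s = src a & f = s *[m] a].
Proof.
case: (step_pathP f) => [u|s a hs e _]; first by left; rewrite src_idn.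
by right; exists s, a.
Qed.

Definition normal u : Prop := forall s, Sstsize s = 1 -> src s <> u.

Lemma normal_src f : normal (src f) -> f = idn (Sst P) (src f).
Proof.
move=> nf; case: (Sst_cases f) => // -[s [a [hs e ef]]].
by case: (nf s hs); rewrite ef src_comp.
Qed.

Lemma normalize : pm_terminating P ->
  forall u, exists h, src h = u /\ normal (tgt h).
Proof.
move=> /ere_step_wf wf u; elim: (wf u) => {}u _ IH.
have [nu|/existsNP[s /not_implyP[hs /contrapT eu]]] := pselect (normal u).
  by exists (idn _ u); rewrite src_idn tgt_idn.
have [|h [h1 h2]] := IH (tgt s); first by rewrite -eu; apply: Sstar_step.
by exists (s *[m] h); rewrite src_comp // tgt_comp.
Qed.

Definition nf_square u : Prop := forall e f g,
  src e = u -> src f = u -> src g = tgt e -> normal (tgt f) -> normal (tgt g) ->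
  exists e', square_cell f g e e'.

(** All reductions of [u] are included because local confluence prolongs a step by a reduction of
    arbitrary length, at whose target a square is required. *)
Definition nf_square_below u : Prop :=
  forall a : Sst P, src a = u -> nf_square (tgt a).

Lemma nf_square_at u : nf_square_below u -> nf_square u.
Proof. by move=> /(_ (idn _ u)); rewrite src_idn tgt_idn; apply. Qed.

Lemma nf_square_cons s a b : nf_square_below (tgt s) ->
  tgt s = src a -> tgt s = src b -> normal (tgt a) -> normal (tgt b) ->
  exists e', square_cell (s *[m] a) (s *[m] b) (idn _ (src s)) e'.
Proof.
move=> /nf_square_at N ea eb na nb.
have [|||||p hp] := N (idn _ (tgt s)) a b; rewrite ?src_idn ?tgt_idn //.
by exists p; apply: fills_V hp => //; apply: fills_idH.
Qed.

(** Three squares are pasted: the one given by confluence, beside it a square from [tgt a'] to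
    normal forms, and above both a comparison of [s *[m] a] with the resulting top over an identity
    edge. *)
Lemma nf_square_extend s a e g : pm_terminating P -> nf_square_below (tgt s) ->
  tgt s = src a -> normal (tgt a) -> src s = src e ->
  branching_confluent Gamma s e g ->
  exists b e', [/\ tgt g = src b, normal (tgt b) &
    square_cell (s *[m] a) (g *[m] b) e e'].
Proof.
move=> term N sa na se [a' [b' [d [A [sa' gb' [A1 A2 A3 A4]]]]]].
have sqA : square_cell (s *[m] a') (g *[m] b') e d by exists A.
have [_ da _ db] := fills_bd Vinv sqA.
have [x [sx nx]] := normalize term (tgt a').
have [y [sy ny]] := normalize term (tgt b').
have [|||||d' sqB] := N a' (esym sa') d x y; rewrite ?sx ?sy //.
- by rewrite -da tgt_comp.
- by rewrite -db tgt_comp.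
have := fills_V Vinv sqA sqB; rewrite -!compA // => sqAB.
have [|||p sqC] := nf_square_cons N sa (b := a' *[m] x);
  rewrite ?src_comp ?tgt_comp //.
exists (b' *[m] y), (p *[m] d'); split; rewrite ?src_comp ?tgt_comp //.
by have := fills_H Vinv sqC sqAB; rewrite se comp1f.
Qed.

Hypothesis term : pm_terminating P.
Hypothesis lconf : locally_confluent Gamma.

Lemma step_neq_idn s u : Sstsize s = 1 -> s <> idn (Sst P) u.
Proof. by move=> hs es; move: hs; rewrite es /Sstsize /Ssize psize_idn. Qed.

(** A nontrivial [f] begins with a step, which forms a local branching with [e] and an identity. For
    a trivial [f], either [tgt e] also has a trivial normalization [h] and the identity square on
    [e] fits, or the first case applies to [h] and the inverse of [e]. *)
Lemma nf_square_edge e f : Esize e = 1 -> src f = src e -> normal (tgt f) ->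
  (forall v, estep (src e) v -> nf_square_below v) ->
  exists h d, [/\ src h = tgt e, normal (tgt h) & square_cell f h e d].
Proof.
have key e0 f0 : Esize e0 = 1 -> src f0 = src e0 -> normal (tgt f0) ->
    (forall v, estep (src e0) v -> nf_square_below v) ->
    f0 <> idn _ (src f0) ->
    exists h d, [/\ src h = tgt e0, normal (tgt h) & square_cell f0 h e0 d].
  move=> he fe nf IH; case: (Sst_cases f0) => // -[s [a [hs sa ef]]] _.
  subst f0; move: fe nf; rewrite src_comp // tgt_comp // => se na.
  have lb : local_branching s e0 (idn _ (tgt e0)).
    split=> //; last by rewrite /Sstsize /Ssize psize_idn.
    by split=> //; [exact: step_neq_idn | rewrite src_idn].
  have N : nf_square_below (tgt s) by apply: IH; rewrite -se; apply: Sstar_step.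
  have [b [d [eb nb sq]]] := nf_square_extend term N sa na se (lconf lb).
  rewrite tgt_idn in eb; exists b, d; split=> //.
  by move: sq; rewrite eb comp1f.
move=> he fe nf IH; have [ef|/key] := pselect (f = idn _ (src f)); last exact.
have nu : normal (src e) by move: nf; rewrite ef tgt_idn fe.
have [h [sh nh]] := normalize term (tgt e).
have [eh|nh'] := pselect (h = idn _ (src h)).
  by exists h, e; split=> //; rewrite eh sh ef fe; apply: fills_idV.
have ie := cinvP (Etop_inv e); case: (ie) => [i1 i2 i3 i4].
(* [e] being traversed backwards, the roles of [f] and [h] are exchanged. *)
have hi : Esize (cinv e) = 1.
  (* Size zero is excluded: the inverse would be an identity, hence so would [e]. *)
  have := gsize_cinv e; rewrite -/(Esize e) he leq_eqVlt ltnS leqn0.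
  case/orP=> /eqP //; move/psize0 => ei.
  have := he; rewrite -(compf1 e) i1 -ei i3.
  by rewrite /Esize /gsize psize_idn.
have [|||//|b [d [sb nb sq]]] := key _ h hi; rewrite -?i1 //.
  move=> v hv; apply: IH; exact: ere_step_precomp.
(* Both [b] and [f] start at the normal cell [src e], so both are its identity. *)
have eb : b = f.
  have eb := @normal_src b; rewrite sb i2 in eb.
  by rewrite (eb nu) ef fe.
exists h, (cinv d); split=> //; move: (fills_inv Vinv sq).
rewrite eb.
suff -> : cinv (cinv e) = e by [].
apply: inverse_unique (cinvP (Etop_inv _)) _.
by split=> //; rewrite ?i3 ?i4 ?i1 ?i2.
Qed.

(** Induction on a decomposition of [e] into edges of size one: each edge yields a square by
    [nf_square_edge], and these are pasted along horizontal sides. For a trivial [e] the first steps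
    of [f] and [g] form a local branching. *)
Lemma nf_square_step u :
  (forall v, estep u v -> nf_square_below v) -> nf_square u.
Proof.
move=> IH e f g eu; move: IH; rewrite -eu => {u eu}.
move: f g; elim: (step_pathP e) => {e} [u|e1 e2 he ee _ IHe] f g.
  rewrite src_idn tgt_idn => IH sf sg nf ng.
  have [ef|[s [a [hs sa ef]]]] := Sst_cases f.
    have nu : normal u by move: nf; rewrite ef tgt_idn sf.
    have eg : g = idn _ (src g) by apply: normal_src; rewrite sg.
    exists (idn _ u); rewrite ef eg sf sg.
    have := fills_idV squares Vinv (idn (Etop P) u).
    by rewrite src_idn tgt_idn.
  have [eg|[t [b [ht tb eg]]]] := Sst_cases g.
    (* A trivial [g] would make [u] normal, although [s] starts there. *)
    by case: (ng s hs); rewrite eg tgt_idn sg -sf ef src_comp.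
  subst f g; move: sf sg nf ng; rewrite !src_comp // !tgt_comp // => ss st na nb.
  have lb : local_branching s (idn _ u) t.
    split=> //; last by rewrite ht /Esize /gsize psize_idn.
    by split; [exact: step_neq_idn | rewrite src_idn | rewrite tgt_idn].
  have Ns : nf_square_below (tgt s) by apply: IH; rewrite -ss; apply: Sstar_step.
  have Nt : nf_square_below (tgt t) by apply: IH; rewrite -st; apply: Sstar_step.
  have ss' : src s = src (idn (Etop P) u) by rewrite src_idn.
  have [b' [d [eb' nb' sq]]] := nf_square_extend term Ns sa na ss' (lconf lb).
  (* The bottom reached so far is [t *[m] b']; this square replaces it by the prescribed [t *[m]
     b]. *)
  have [p sq'] := nf_square_cons Nt eb' tb nb' nb.
  by exists (d *[m] p); have := fills_H Vinv sq sq'; rewrite st idn_comp.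
rewrite src_comp // tgt_comp // => IH sf sg nf ng.
have [h [d [sh nh sq]]] := nf_square_edge he sf nf IH.
have [|||||d' sq'] := IHe h g; rewrite ?sh -?ee //.
  by move=> v hv; apply: IH; exact: ere_step_precomp.
by exists (d *[m] d'); exact: (fills_H Vinv sq sq').
Qed.

Lemma nf_squareP u : nf_square u.
Proof.
suff : nf_square_below u by apply: nf_square_at.
elim: (ere_step_wf term u) => {}u _ IH a.
(* A trivial [a] leaves the square at [u] itself; otherwise the first step of [a] leads to a smaller
   cell, where the induction hypothesis covers the rest of [a]. *)
have [->|[s [b [hs sb ->]]]] := Sst_cases a.
  by rewrite src_idn tgt_idn => ->; apply: nf_square_step.
rewrite src_comp // tgt_comp // => su.
by apply: (IH (tgt s)); rewrite // -su; apply: Sstar_step.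
Qed.

End Newman.

Theorem theorem5p1p5 (m : nat) (P : polmod m)
    (Gamma : sqext (Etop P) (Sst P)) :
  pm_terminating P -> locally_confluent Gamma -> confluent Gamma.
Proof.
move=> term lconf f e g [_ fe ge].
(* The confluence witnesses are reductions of the two targets to normal forms. *)
have [f' [sf nf]] := normalize term (tgt f).
have [g' [sg ng]] := normalize term (tgt g).
have [|||||e' [A hA]] := nf_squareP term lconf (u := src f)
  (e := e) (f := f *[m] f') (g := g *[m] g');
  rewrite ?src_comp ?tgt_comp //.
by exists f', g', e', A; split.
Qed.
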